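(* Let $\Pi=\{\pi_i: i\in[l]\}$, $l\le c$, be a complete family of mutually orthogonal orthogonal projections on $\mathbb C^c$, and let $\mathcal D_\Pi\subset\mathcal D_c$ be the corresponding commutative submanifold, $\mathcal D_{\Pi,c}=\prod_{i\in\mathcal V}\mathcal D_\Pi\subset\mathcal Q_c$. Then the following holds. (i) If $\mu\in\mathcal D_{\Pi,c}\subset\mathcal Q_c$, then $\mathfrak R_\mu\big[\Omega[\mu]\big]\in T_\mu\mathcal D_{\Pi,c}\subseteq T_\mu\mathcal Q_c$. (ii) If $\Pi=\Pi_{\mathcal U}=\{u_iu_i^*: i\in[c]\}$ for an orthonormal basis $\mathcal U=\{u_1,\dots,u_c\}$ of $\mathbb C^c$, $U=(u_1,\dots,u_c)$ is the corresponding unitary matrix and $U_c$ is the block-diagonal matrix with $|\mathcal V|$ diagonal blocks $U$, then for $\mu\in\mathcal D_{\Pi_{\mathcal U},c}$ $$\mathfrak R_\mu\big[\Omega[\mu]\big]=U_c\operatorname{Diag}\big[R_S[\Omega S]\big]U_c^*,$$ i.e. $\mathfrak R_\mu[\Omega[\mu]]_i=U\operatorname{Diag}\big((R_S[\Omega S])_i\big)U^*$ for all $i\in\mathcal V$, where $S\in\mathcal W_c$ is determined by $\mu_i=U\operatorname{Diag}(S_i)U^*$, $i\in\mathcal V$. In particular, the submanifold $\mathcal D_{\Pi,c}$ is preserved by the quantum state assignment flow $\dot\mu=\mathfrak R_\mu[\Omega[\mu]]$.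
   Context: $[n]=\{1,\dots,n\}$. Fix $c\in\mathbb N$. $\mathcal H_c=\{X\in\mathbb C^{c\times c}: X^*=X\}$, $\mathcal H_{c,0}=\{X\in\mathcal H_c:\operatorname{tr}X=0\}$, $\mathcal D_c=\{\rho\in\mathcal H_c:\rho\succ0,\operatorname{tr}\rho=1\}$, with $T_\rho\mathcal D_c=\mathcal H_{c,0}$. $\langle A,B\rangle=\operatorname{tr}(AB)$. For $\rho\in\mathcal D_c$, $X\in\mathcal H_c$: $\mathfrak R_\rho[X]=\mathbb T_\rho^{-1}[X]-\langle\rho,X\rangle\rho$ with $\mathbb T_\rho^{-1}[X]=\int_0^1\rho^{1-\lambda}X\rho^\lambda d\lambda$. Graph: $\mathcal G=(\mathcal V,\mathcal E,\omega)$ is a finite weighted graph, $\mathcal N_i=\{i\}\cup\{k\in\mathcal V: ik\in\mathcal E\}$, $\omega_{ik}\ge0$, $\omega_{ik}=0$ if $k\notin\mathcal N_i$, $\sum_{k\in\mathcal N_i}\omega_{ik}=1$, $\omega_{ij}=\omega_{ji}$ and $j\in\mathcal N_i\Leftrightarrow i\in\mathcal N_j$ for all $i,j\in\mathcal V$. $\mathcal Q_c=\prod_{i\in\mathcal V}\mathcal D_c$. $\Omega[\mu]_i=\sum_{k\in\mathcal N_i}\omega_{ik}\mu_k$, and $\mathfrak R_\mu[X]_i=\mathfrak R_{\mu_i}[X_i]$ for $\mu\in\mathcal Q_c$. Commutative submanifold: the $\pi_i$ are (nonzero) orthogonal projections with $\pi_i^2=\pi_i$, $\pi_i\pi_j=0$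 for $i\ne j$, $\sum_{i\in[l]}\pi_i=I_c$, and $\mathcal D_\Pi=\{\sum_{i\in[l]}\frac{p_i}{\operatorname{tr}\pi_i}\pi_i: p\in\mathcal S_l\}$, where $\mathcal S_n=\{p\in\mathbb R^n: p_j>0,\ \sum_jp_j=1\}$. Classical objects: $\mathcal W_c=\prod_{i\in\mathcal V}\mathcal S_c$, whose elements are row-stochastic matrices $S$ with rows $S_i\in\mathcal S_c$; $\Omega$ also denotes the $|\mathcal V|\times|\mathcal V|$ matrix with entries $\omega_{ik}$, so $(\Omega S)_i=\sum_{k\in\mathcal N_i}\omega_{ik}S_k$; $R_p=\operatorname{Diag}(p)-pp^\top$ and $R_S[\Omega S]_i=R_{S_i}(\Omega S)_i$. $\operatorname{Diag}[R_S[\Omega S]]$ is the block-diagonal matrix with blocks $\operatorname{Diag}((R_S[\Omega S])_i)$, and $\mathfrak R_\mu[\Omega[\mu]]$ is correspondingly identified with the block-diagonal matrix of its factors. *)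

(* Defs.v *)
From HB Require Import structures.
From mathcomp Require Import all_boot all_order all_algebra.
From mathcomp Require Import all_classical all_reals all_analysis.
From mathcomp Require Import complex.

Set Implicit Arguments.
Unset Strict Implicit.
Unset Printing Implicit Defensive.

Import Order.TTheory GRing.Theory Num.Theory.
Import numFieldNormedType.Exports.

Local Open Scope classical_set_scope.
Local Open Scope ring_scope.
Local Open Scope complex_scope.
Local Open Scope sesquilinear_scope.

Section Matrices.
Context {R : realType} {c : nat}.
Implicit Types rho X : 'M[R[i]]_c.

Definition Herm : set 'M[R[i]]_c := [set X | X \is hermsymmx].

Definition Herm0 : set 'M[R[i]]_c := [set X | Herm X /\ \tr X = 0].

(* The order on R[i] is partial: 0 < z means that z is real and positive. *)
Definition posdef X : Prop :=
  forall v : 'cV[R[i]]_c, v != 0 -> 0 < (v^t* *m X *m v) 0 0.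

Definition density : set 'M[R[i]]_c :=
  [set rho | [/\ Herm rho, posdef rho & \tr rho = 1]].

(* rho ^ a by functional calculus: rho = P^-1 *m diag_mx d *m P with P unitary
   is the spectral decomposition of the library, and rho ^ a applies the real
   power function to the eigenvalues. It is only used for rho in [density],
   where the eigenvalues are real and positive. *)
Definition mxpow rho (a : R) : 'M[R[i]]_c :=
  let P := spectralmx rho in
  invmx P *m diag_mx (map_mx (fun z : R[i] => (complex.Re z `^ a)%:C)
                        (spectral_diag rho)) *m P.

Definition mxintegral01 (f : R -> 'M[R[i]]_c) : 'M[R[i]]_c :=
  \matrix_(j, k)
    ((\int[lebesgue_measure]_(s in `[0%R, 1%R]) complex.Re (f s j k))
     +i* (\int[lebesgue_measure]_(s in `[0%R, 1%R]) complex.Im (f s j k))).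

Definition Tinv rho X : 'M[R[i]]_c :=
  mxintegral01 (fun s => mxpow rho (1 - s) *m X *m mxpow rho s).

Definition mxinner (A B : 'M[R[i]]_c) : R[i] := \tr (A *m B).

Definition qreplicator rho X : 'M[R[i]]_c :=
  Tinv rho X - mxinner rho X *: rho.

End Matrices.

Section Graph.
Context {R : realType} {V : finType}.

Definition nbhood (e : rel V) (i : V) : {set V} := [set k | (k == i) || e i k].

Record wgraph := WGraph {
  edge : rel V;
  weight : V -> V -> R;
  nbhood_sym : forall i j, (j \in nbhood edge i) = (i \in nbhood edge j);
  weight_ge0 : forall i k, 0 <= weight i k;
  weight_out : forall i k, k \notin nbhood edge i -> weight i k = 0;
  weight_sum1 : forall i, \sum_(k in nbhood edge i) weight i k = 1;
  weight_sym : forall i j, weight i j = weight j i }.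

End Graph.
Arguments wgraph : clear implicits.

Section QuantumFlow.
Context {R : realType} {V : finType} {c : nat}.
Implicit Types (mu X : V -> 'M[R[i]]_c).

Definition Qmanifold : set (V -> 'M[R[i]]_c) :=
  [set mu | forall i, density (mu i)].

Definition tangent_Q mu : set (V -> 'M[R[i]]_c) :=
  [set X | forall i, Herm0 (X i)].

Definition similarity (G : wgraph R V) mu : V -> 'M[R[i]]_c :=
  fun i => \sum_(k in nbhood (edge G) i) (weight G i k)%:C *: mu k.

Definition qreplicators mu X : V -> 'M[R[i]]_c :=
  fun i => qreplicator (mu i) (X i).

Definition curve_derive (g : R -> V -> 'M[R[i]]_c) (t : R) X : Prop :=
  forall i j k,
    is_derive t 1 (fun s : R => complex.Re (g s i j k)) (complex.Re (X i j k)) /\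
    is_derive t 1 (fun s : R => complex.Im (g s i j k)) (complex.Im (X i j k)).

Definition curve_continuous_on (J : set R) (g : R -> V -> 'M[R[i]]_c) : Prop :=
  forall i j k,
    {within J, continuous (fun s : R => complex.Re (g s i j k))} /\
    {within J, continuous (fun s : R => complex.Im (g s i j k))}.

(* T_mu M as the set of velocities at mu of the differentiable curves
   ]-e, e[ -> M through mu, for M a submanifold of the product of the matrix
   spaces. *)
Definition tangent (M : set (V -> 'M[R[i]]_c)) mu : set (V -> 'M[R[i]]_c) :=
  [set X | exists (g : R -> V -> 'M[R[i]]_c) (e : R),
     [/\ 0 < e, g 0 = mu,
         forall t, `|t| < e -> M (g t) /\ exists Y, curve_derive g t Y
       & curve_derive g 0 X]].

(* Solutions on an arbitrary interval J, open at either end or not; at an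
   endpoint of J that belongs to J only continuity is required. *)
Definition qflow_solution (G : wgraph R V) (J : set R)
    (g : R -> V -> 'M[R[i]]_c) : Prop :=
  [/\ is_interval J,
      forall t, J t -> Qmanifold (g t),
      curve_continuous_on J g
    & forall t, interior J t ->
        curve_derive g t (qreplicators (g t) (similarity G (g t)))].

Definition flow_preserved (G : wgraph R V) (M : set (V -> 'M[R[i]]_c)) : Prop :=
  forall (J : set R) (g : R -> V -> 'M[R[i]]_c) (t0 : R),
    qflow_solution G J g -> J t0 -> M (g t0) -> forall t, J t -> M (g t).

End QuantumFlow.

Section Simplex.
Context {R : realType} {n : nat}.

Definition simplex : set 'cV[R]_n :=
  [set p | (forall j, 0 < p j 0) /\ \sum_j p j 0 = 1].

Definition replicator_mx (p : 'cV[R]_n) : 'M[R]_n := diag_mx p^T - p *m p^T.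

End Simplex.

Section ClassicalFlow.
Context {R : realType} {V : finType} {c : nat}.

(* A row-stochastic matrix S is given by its rows S_i, as column vectors. *)
Definition Wmanifold : set (V -> 'cV[R]_c) := [set S | forall i, simplex (S i)].

Definition csimilarity (G : wgraph R V) (S : V -> 'cV[R]_c) : V -> 'cV[R]_c :=
  fun i => \sum_(k in nbhood (edge G) i) weight G i k *: S k.

Definition replicators (S X : V -> 'cV[R]_c) : V -> 'cV[R]_c :=
  fun i => replicator_mx (S i) *m X i.

End ClassicalFlow.

Section Commutative.
Context {R : realType} {c : nat}.

Definition complete_projections (l : nat) (P : 'I_l -> 'M[R[i]]_c) : Prop :=
  [/\ forall i, Herm (P i) /\ P i != 0,
      forall i, P i *m P i = P i,
      forall i j, i != j -> P i *m P j = 0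
    & \sum_i P i = 1%:M].

Definition comm_density (l : nat) (P : 'I_l -> 'M[R[i]]_c) :
    set 'M[R[i]]_c :=
  [set rho | exists2 p : 'cV[R]_l, simplex p &
     rho = \sum_i ((p i 0)%:C / \tr (P i)) *: P i].

Definition comm_Q (V : finType) (l : nat) (P : 'I_l -> 'M[R[i]]_c) :
    set (V -> 'M[R[i]]_c) :=
  [set mu | forall i, comm_density P (mu i)].

Definition orthonormal_basis (u : 'I_c -> 'cV[R[i]]_c) : Prop :=
  forall j k, (u j)^t* *m u k = ((j == k)%:R)%:M.

Definition basis_mx (u : 'I_c -> 'cV[R[i]]_c) : 'M[R[i]]_c :=
  \matrix_(j, k) u k j 0.

Definition rank1_projections (u : 'I_c -> 'cV[R[i]]_c) :
    'I_c -> 'M[R[i]]_c :=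
  fun j => u j *m (u j)^t*.

Definition Diag (x : 'cV[R]_c) : 'M[R[i]]_c :=
  diag_mx (map_mx (real_complex R) x^T).

(* The blocks are ordered by the enumeration of the vertices. *)
Definition block_diag (V : finType) (B : V -> 'M[R[i]]_c) :
    'M[R[i]]_(\sum_(i < #|V|) c) :=
  \mxdiag_(i < #|V|) B (enum_val i).

End Commutative.

(* Main.v *)
Require Import Defs.
From mathcomp Require Import all_boot all_order all_algebra.
From mathcomp Require Import all_classical all_reals all_analysis.
From mathcomp Require Import complex.
From mathcomp Require Import ring.

Set Implicit Arguments.
Unset Strict Implicit.
Unset Printing Implicit Defensive.

Import Order.TTheory GRing.Theory Num.Theory.
Import numFieldNormedType.Exports.

Local Open Scope classical_set_scope.
Local Open Scope ring_scope.
Local Open Scope complex_scope.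
Local Open Scope sesquilinear_scope.

(** Along a complete family of orthogonal projections pi_a all matrices commute,
and functional calculus acts on the coefficients: if rho is the combination of
the pi_a with positive coefficients q_a, then rho ^ s has coefficients
q_a ^ s ([mxpow_comb]).  For X in the span of the pi_a the integrand
rho ^ (1 - s) X rho ^ s is therefore the constant rho X, and the quantum
replicator becomes the classical expression q_a x_a - <q, x> q_a
([qreplicator_comb]).  The averages formed by the graph stay in the span, so the
vector field at a point of the commutative submanifold has real coefficients of
trace zero and is the velocity of a line segment inside the submanifold
([replicator_tangent]).  For rank-one projections the same formula, read in the
basis u, is the classical replicator ([qreplicators_classical]).

Invariance under the flow needs a uniqueness argument, because a solution is only
known to be a curve of density matrices.  Let K commute with all pi_a.  The
commutators [K, mu_i] satisfy a closed linear differential inequality: the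
derivation X |-> [K, X] passes through the integral defining the replicator at
the cost of [K, rho ^ s], and that is controlled by [K, rho] as long as the
eigenvalues of rho stay away from 0.  In an eigenbasis of rho the integral is the
Schur product with the matrix of logarithmic means of the eigenvalues, whose
entries are Lipschitz in each eigenvalue; this gives the estimate in the form
used here ([nrm_lie_schur], [replicator_lie_bound]).  On a compact time interval
the determinants of the mu_i have a positive minimum, which bounds the
eigenvalues from below since they are at most 1.  Gronwall ([gronwall_zero]), in
both time directions, propagates [K, mu_i] = 0 from one time to all times.
Finally a density matrix that commutes with every such K lies in the submanifold
([commutant_comm_density]): it is the double commutant theorem for the algebra
spanned by the pi_a, where compressions pi_a Y pi_a suffice as test matrices. *)

(** * Conjugate transposes and real combinations of projections *)

Section RealImaginaryParts.
Context {R : realType}.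

Lemma ReD (x y : R[i]) : complex.Re (x + y) = complex.Re x + complex.Re y.
Proof. by case: x y => [? ?] [? ?]. Qed.

Lemma ImD (x y : R[i]) : complex.Im (x + y) = complex.Im x + complex.Im y.
Proof. by case: x y => [? ?] [? ?]. Qed.

Lemma Re_sum (T : Type) (r : seq T) (p : pred T) (F : T -> R[i]) :
  complex.Re (\sum_(a <- r | p a) F a) = \sum_(a <- r | p a) complex.Re (F a).
Proof. exact: (big_morph _ ReD). Qed.

Lemma Im_sum (T : Type) (r : seq T) (p : pred T) (F : T -> R[i]) :
  complex.Im (\sum_(a <- r | p a) F a) = \sum_(a <- r | p a) complex.Im (F a).
Proof. exact: (big_morph _ ImD). Qed.

Lemma Re_scale (a : R) (z : R[i]) : complex.Re (a%:C * z) = a * complex.Re z.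
Proof. by case: z => x y; rewrite /= mul0r subr0. Qed.

Lemma Im_scale (a : R) (z : R[i]) : complex.Im (a%:C * z) = a * complex.Im z.
Proof. by case: z => x y; rewrite /= mul0r addr0. Qed.

Lemma ReM (x y : R[i]) : complex.Re (x * y) =
  complex.Re x * complex.Re y - complex.Im x * complex.Im y.
Proof. by case: x y => [? ?] [? ?]. Qed.

Lemma ImM (x y : R[i]) : complex.Im (x * y) =
  complex.Re x * complex.Im y + complex.Im x * complex.Re y.
Proof. by case: x y => [? ?] [? ?]. Qed.

Lemma normc_le (z : R[i]) (M : R) : `|complex.Re z| <= M -> `|complex.Im z| <= M ->
  `|z| <= (M *+ 2)%:C.
Proof.
move=> h1 h2; have -> : z = (complex.Re z)%:C + 'i%C * (complex.Im z)%:C.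
  exact: complexE.
rewrite (le_trans (ler_normD _ _)) // normrM mulr2n rmorphD /=.
have nC (x : R) : `|x%:C| = `|x|%:C by rewrite normc_def /= expr0n addr0 sqrtr_sqr.
by rewrite !nC normc_def /= expr0n add0r expr1n sqrtr1 mul1r lerD ?lecR.
Qed.

Lemma Re_le_norm (z : R[i]) (M : R) : `|z| <= M%:C -> `|complex.Re z| <= M.
Proof. by move=> h; rewrite -lecR (le_trans (normc_ge_Re z)). Qed.

Lemma Im_le_norm (z : R[i]) (M : R) : `|z| <= M%:C -> `|complex.Im z| <= M.
Proof.
move=> h; have := @Re_le_norm (z * 'i%C) M.
rewrite ReiNIm normrN; apply; rewrite normrM.
by rewrite (_ : `|'i%C| = 1) ?mulr1 // normc_def /= expr0n add0r expr1n sqrtr1.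
Qed.

End RealImaginaryParts.

Section ConjugateTranspose.
Context {R : realType}.

Lemma ctrM m n p (A : 'M[R[i]]_(m, n)) (B : 'M[R[i]]_(n, p)) :
  (A *m B)^t* = B^t* *m A^t*.
Proof. by rewrite trmx_mul map_mxM. Qed.

Lemma ctr_sum m n (I : finType) (F : I -> 'M[R[i]]_(m, n)) :
  (\sum_a F a)^t* = \sum_a (F a)^t*.
Proof. by rewrite raddf_sum /= raddf_sum. Qed.

Lemma ctrZ m n (a : R) (A : 'M[R[i]]_(m, n)) : (a%:C *: A)^t* = a%:C *: A^t*.
Proof.
apply/matrixP => j k; rewrite !mxE rmorphM /=; congr (_ * _).
exact: (conjc_real a).
Qed.

Lemma HermE c (X : 'M[R[i]]_c) : Herm X <-> X^t* = X.
Proof.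
rewrite /Herm /=; split=> [/is_hermitianmxP|]; rewrite ?expr0 ?scale1r //.
by move=> e; apply/is_hermitianmxP; rewrite expr0 scale1r e.
Qed.

Lemma tr_ctr_mul m n (A : 'M[R[i]]_(m, n)) :
  \tr (A^t* *m A) = \sum_k \sum_j `|A j k| ^+ 2.
Proof.
apply: eq_bigr => k _; rewrite mxE; apply: eq_bigr => j _.
by rewrite !mxE mulrC -normCK.
Qed.

Lemma tr_ctr_mul_gt0 m n (A : 'M[R[i]]_(m, n)) :
  A != 0 -> 0 < \tr (A^t* *m A).
Proof.
move=> A0; rewrite lt_def tr_ctr_mul; apply/andP; split; last first.
  by apply: sumr_ge0 => k _; apply: sumr_ge0 => j _; apply: exprn_ge0.
apply: contra A0; rewrite psumr_eq0; last first.
  by move=> k _; apply: sumr_ge0 => j _; apply: exprn_ge0.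
move=> /allP h; apply/eqP/matrixP => j k; rewrite mxE.
move: (h k (mem_index_enum _)); rewrite /= psumr_eq0; last first.
  by move=> ? _; apply: exprn_ge0.
move=> /allP/(_ j (mem_index_enum _)) /=.
by rewrite sqrf_eq0 normr_eq0 => /eqP.
Qed.

End ConjugateTranspose.

Section Rank1.
Context {R : realType} {c : nat} (u : 'I_c -> 'cV[R[i]]_c).
Hypothesis hu : orthonormal_basis u.

Lemma basis_mx_ctr_mul : (basis_mx u)^t* *m basis_mx u = 1%:M.
Proof.
apply/matrixP => j k; have := congr1 (fun M : 'M[R[i]]_1 => M 0 0) (hu j k).
rewrite !mxE eqxx mulr1n => <-; apply: eq_bigr => a _.
by rewrite !mxE.
Qed.

Lemma basis_mx_mul_ctr : basis_mx u *m (basis_mx u)^t* = 1%:M.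
Proof. by apply: mulmx1C; exact: basis_mx_ctr_mul. Qed.

(** The bridge between the two descriptions of matrices diagonal in the basis u:
combinations of the projections on the basis vectors, and conjugates of diagonal
matrices. *)
Lemma basis_mx_diag (x : 'I_c -> R[i]) :
  \sum_a x a *: rank1_projections u a =
  basis_mx u *m diag_mx (\row_a x a) *m (basis_mx u)^t*.
Proof.
apply/matrixP => j k; rewrite mul_mx_diag mxE summxE; apply: eq_bigr => a _.
by rewrite !mxE big_ord1 !mxE mulrCA mulrA.
Qed.

Lemma rank1_tr a : \tr (rank1_projections u a) = 1.
Proof. by rewrite mxtrace_mulC hu eqxx mxtrace_scalar. Qed.

Lemma rank1_complete : complete_projections (rank1_projections u).
Proof.
have mulE a b : rank1_projections u a *m rank1_projections u b =
    (a == b)%:R *: (u a *m (u b)^t*).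
  by rewrite /rank1_projections mulmxA -(mulmxA (u a)) hu mul_mx_scalar scalemxAl.
split.
- move=> a; split; last first.
    by apply/eqP => e; have := rank1_tr a; rewrite e mxtrace0 => /esym/eqP; rewrite oner_eq0.
  by apply/HermE; rewrite ctrM trmxCK.
- by move=> a; rewrite mulE eqxx scale1r.
- by move=> a b /negPf nab; rewrite mulE nab scale0r.
- rewrite -basis_mx_mul_ctr.
  have := basis_mx_diag (fun=> 1); under eq_bigr do rewrite scale1r.
  move=> ->; congr (_ *m _).
  rewrite -[RHS]mulmx1; congr (_ *m _).
  by apply/matrixP => j k; rewrite !mxE.
Qed.

End Rank1.

Section Combinations.
Context {R : realType} {c l : nat} (P : 'I_l -> 'M[R[i]]_c).
Hypothesis hP : complete_projections P.

(** The coefficients are not divided by the ranks: sums, products and powers then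
act coefficientwise, and the ranks enter only through the trace. *)
Definition comb (q : 'I_l -> R) : 'M[R[i]]_c := \sum_a (q a)%:C *: P a.

Lemma proj_ctr a : (P a)^t* = P a.
Proof. by case: hP => /(_ a) [/HermE]. Qed.

Lemma proj_mul a b : P a *m P b = (a == b)%:R *: P a.
Proof.
case: hP => _ id ort _; case: eqP => [<-|/eqP ab]; first by rewrite scale1r.
by rewrite ort // scale0r.
Qed.

Lemma proj_tr_gt0 a : 0 < \tr (P a).
Proof.
case: hP => /(_ a) [_ P0] _ _ _.
by rewrite -[P a]scale1r -[1]/((true)%:R) -[true](eqxx a) -proj_mul -{1}proj_ctr tr_ctr_mul_gt0.
Qed.

Definition prank a : R := complex.Re (\tr (P a)).

Lemma prankE a : \tr (P a) = (prank a)%:C.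
Proof. by rewrite RRe_real // gtr0_real // proj_tr_gt0. Qed.

Lemma prank_gt0 a : 0 < prank a.
Proof. by rewrite -ltcR -prankE proj_tr_gt0. Qed.

Lemma comb_projl q a : P a *m comb q = (q a)%:C *: P a.
Proof.
rewrite /comb mulmx_sumr (bigD1 a) //= big1 ?addr0.
  by rewrite -scalemxAr proj_mul eqxx scale1r.
by move=> b ba; rewrite -scalemxAr proj_mul eq_sym (negPf ba) scale0r scaler0.
Qed.

Lemma comb_projr q a : comb q *m P a = (q a)%:C *: P a.
Proof.
rewrite /comb mulmx_suml (bigD1 a) //= big1 ?addr0.
  by rewrite -scalemxAl proj_mul eqxx scale1r.
by move=> b ba; rewrite -scalemxAl proj_mul (negPf ba) scale0r scaler0.
Qed.

Lemma comb_mul q x : comb q *m comb x = comb (fun a => q a * x a).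
Proof.
rewrite {1}/comb mulmx_suml; apply: eq_bigr => a _.
by rewrite -scalemxAl comb_projl scalerA -rmorphM.
Qed.

Lemma comb_sub q x : comb q - comb x = comb (fun a => q a - x a).
Proof. by rewrite -sumrB; apply: eq_bigr => a _; rewrite -scalerBl -rmorphB. Qed.

Lemma comb_scale (k : R) q : k%:C *: comb q = comb (fun a => k * q a).
Proof. by rewrite scaler_sumr; apply: eq_bigr => a _; rewrite scalerA -rmorphM. Qed.

Lemma comb_tr q : \tr (comb q) = (\sum_a q a * prank a)%:C.
Proof.
rewrite raddf_sum rmorph_sum; apply: eq_bigr => a _ /=.
by rewrite mxtraceZ prankE rmorphM.
Qed.

Lemma comb_ctr q : (comb q)^t* = comb q.
Proof. by rewrite ctr_sum; apply: eq_bigr => a _; rewrite ctrZ proj_ctr. Qed.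

(** The weight p_a of the simplex is q_a times the rank of the projection, so
the normalization of p becomes the trace condition on q. *)
Lemma comm_densityP rho : comm_density P rho <->
  exists2 q : 'I_l -> R, (forall a, 0 < q a) /\ \sum_a q a * prank a = 1 &
    rho = comb q.
Proof.
split=> [[p [p0 p1] ->]|[q [q0 q1] ->]].
  exists (fun a => p a 0 / prank a); last first.
    by apply: eq_bigr => a _; rewrite prankE rmorphM fmorphV.
  split=> [a|]; first by rewrite divr_gt0 ?prank_gt0.
  by rewrite -p1; apply: eq_bigr => a _; rewrite divfK // gt_eqF ?prank_gt0.
exists (\col_a (q a * prank a)).
  split=> [a|]; first by rewrite mxE mulr_gt0 ?prank_gt0.
  by rewrite -q1; apply: eq_bigr => a _; rewrite mxE.
apply: eq_bigr => a _.
by rewrite prankE mxE -fmorphV -rmorphM mulfK // gt_eqF ?prank_gt0.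
Qed.

Lemma comm_density_density rho : comm_density P rho -> density rho.
Proof.
move=> /comm_densityP[q [q0 q1] ->]; split.
- exact/HermE/comb_ctr.
- move=> v v0; rewrite /comb mulmx_sumr mulmx_suml summxE.
  have E a : (v^t* *m ((q a)%:C *: P a) *m v) 0 0 =
      (q a)%:C * \tr ((P a *m v)^t* *m (P a *m v)).
    rewrite ctrM proj_ctr mulmxA -[v^t* *m P a *m P a]mulmxA proj_mul eqxx scale1r.
    by rewrite -scalemxAr -scalemxAl mxE [in RHS]/mxtrace big_ord1.
  under eq_bigr do rewrite E.
  have pos a : 0 <= (q a)%:C * \tr ((P a *m v)^t* *m (P a *m v)).
    rewrite mulr_ge0 // ?ler0c ?(ltW (q0 a)) //.
    have [->|n0] := eqVneq (P a *m v) 0; first by rewrite mulmx0 mxtrace0.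
    exact/ltW/tr_ctr_mul_gt0.
  have [a Pa] : exists a, P a *m v != 0.
    apply: contrapT => /forallNP h; move: v0; rewrite -[v]mul1mx.
    case: hP => _ _ _ <-; rewrite mulmx_suml big1 ?eqxx // => a _.
    by apply/eqP/negP => /negP; exact: h.
  rewrite (bigD1 a) //= ltr_wpDr // ?sumr_ge0 //.
  by rewrite mulr_gt0 // ?ltr0c ?tr_ctr_mul_gt0 // ltcR.
- by rewrite comb_tr q1.
Qed.

End Combinations.

(** * The replicator on a commutative family *)

Section UnitInterval.
Context {R : realType}.

Lemma Rintegral01_cst (r : R) : \int[lebesgue_measure]_(s in `[0%R, 1%R]) r = r.
Proof. by rewrite Rintegral_cst //= lebesgue_measure_itv /= lte_fin ltr01 -EFinB subr0 /= mulr1. Qed.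

Lemma mxintegral01_cst c (A : 'M[R[i]]_c) : mxintegral01 (fun=> A) = A.
Proof.
apply/matrixP => j k; rewrite mxE !Rintegral01_cst.
by case: (A j k).
Qed.

End UnitInterval.

Section CommutativeReplicator.
Context {R : realType} {c l : nat} (P : 'I_l -> 'M[R[i]]_c).
Hypothesis hP : complete_projections P.

(** [mxpow] is defined through a spectral decomposition chosen without regard to
the projections.  If Q diagonalizes the combination, then each column of Q P_a is
an eigenvector of the diagonal factor D for the eigenvalue q_a, so wherever
(Q P_a)_jk is nonzero the j-th diagonal entry of D is q_a; hence f(D) acts on
Q P_a as f(q_a) for every function f. *)
Lemma mxpow_comb q s : mxpow (comb P q) s = comb P (fun a => q a `^ s).
Proof.
rewrite /mxpow; set Q := spectralmx _; set D := spectral_diag _.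
have uQ : Q \in unitmx := spectral_unit _.
have E : Q *m comb P q = diag_mx D *m Q.
  have /orthomx_spectralP -> : comb P q \is normalmx.
    by apply: hermitian_normalmx; apply/HermE; exact: comb_ctr.
  by rewrite !mulmxA mulmxV // mul1mx.
rewrite -[LHS]mulmx1; case: (hP) => _ _ _ <-; rewrite mulmx_sumr.
apply: eq_bigr => a _; rewrite -!mulmxA.
suff -> : diag_mx (map_mx (fun z : R[i] => (complex.Re z `^ s)%:C) D) *m (Q *m P a)
    = (q a `^ s)%:C *: (Q *m P a) by rewrite -scalemxAr mulKmx.
have : diag_mx D *m (Q *m P a) = (q a)%:C *: (Q *m P a).
  by rewrite mulmxA -E -mulmxA comb_projr // -scalemxAr.
move: (Q *m P a) => A /matrixP h; apply/matrixP => j k.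
move: (h j k); rewrite !mul_diag_mx !mxE.
have [->|A0 /(mulIf A0) ->] := eqVneq (A j k) 0; first by rewrite !mulr0.
by [].
Qed.

(** All factors commute, so the integrand is the constant product. *)
Lemma Tinv_comb q x : (forall a, 0 < q a) ->
  Tinv (comb P q) (comb P x) = comb P (fun a => q a * x a).
Proof.
move=> q0; rewrite -[RHS]mxintegral01_cst; congr mxintegral01.
apply/funext => s; rewrite !mxpow_comb !comb_mul //.
congr comb; apply/funext => a; rewrite mulrAC -powRD ?subrK ?powRr1 ?ltW //.
by rewrite gt_eqF ?implybT.
Qed.

Lemma qreplicator_comb q x : (forall a, 0 < q a) ->
  qreplicator (comb P q) (comb P x) =
  comb P (fun a => q a * x a - (\sum_b q b * x b * prank P b) * q a).
Proof.
move=> q0.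
by rewrite /qreplicator /mxinner Tinv_comb // comb_mul // comb_tr // comb_scale comb_sub.
Qed.

End CommutativeReplicator.

(** * The logarithmic mean *)

Section Integrals.
Context {R : realType}.
Implicit Types (f g : R -> R).

Let mu := @lebesgue_measure R.
Local Notation I01 := (`[0%R, 1%R]%classic : set R).

Lemma continuous_integrable01 f : continuous f ->
  mu.-integrable I01 (EFin \o f).
Proof.
move=> cf; apply: continuous_compact_integrable; first exact: segment_compact.
exact: continuous_subspaceT.
Qed.

Lemma continuous_bigsum (U : topologicalType) (T : Type) (r : seq T)
    (f : T -> U -> R) :
  (forall a, continuous (f a)) -> continuous (fun s => \sum_(a <- r) f a s).
Proof.
move=> cf; elim: r => [|a r IH] s.
  by under eq_fun do rewrite big_nil; exact: cvg_cst.
by under eq_fun do rewrite big_cons; apply: cvgD; [exact: cf|exact: IH].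
Qed.

Lemma Rintegral01_sum (T : Type) (r : seq T) (F : T -> R -> R) :
  (forall a, continuous (F a)) ->
  \int[mu]_(s in I01) (\sum_(a <- r) F a s) =
  \sum_(a <- r) \int[mu]_(s in I01) F a s.
Proof.
move=> cF; elim: r => [|a r IH].
  by rewrite big_nil; under eq_Rintegral do rewrite big_nil; exact: Rintegral01_cst.
rewrite big_cons -IH -RintegralD //.
- by apply: eq_Rintegral => s _; rewrite big_cons.
- exact: continuous_integrable01.
- exact/continuous_integrable01/continuous_bigsum.
Qed.

(** The Lipschitz estimates for the logarithmic mean come from pointwise
estimates of the integrand through this bound. *)
Lemma Rintegral01_dist f g (C : R) : continuous f -> continuous g ->
  (forall s, 0 <= s <= 1 -> `|f s - g s| <= C) ->
  `|\int[mu]_(s in I01) f s - \int[mu]_(s in I01) g s| <= C.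
Proof.
have one_side (u v : R -> R) : continuous u -> continuous v ->
    (forall s, 0 <= s <= 1 -> `|u s - v s| <= C) ->
    \int[mu]_(s in I01) u s <= \int[mu]_(s in I01) v s + C.
  move=> cu cv uv; rewrite -[C in leRHS]Rintegral01_cst -RintegralD //.
  - apply: le_Rintegral => //; first exact: continuous_integrable01.
      apply: (@continuous_integrable01 (fun s => v s + C)) => s.
      by apply: continuousD; [exact: cv|exact: cst_continuous].
    move=> s; rewrite /= in_itv /= => /uv; rewrite ler_norml => /andP[_].
    by rewrite lerBlDl.
  - exact: continuous_integrable01.
  - by apply: continuous_integrable01; exact: cst_continuous.
move=> cf cg fg; rewrite ler_norml lerBlDl one_side // andbT.
rewrite lerBrDr addrC lerBlDr one_side // => s /fg.
by rewrite distrC.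
Qed.

End Integrals.

Section LogarithmicMean.
Context {R : realType}.
Implicit Types a b : R.

(** The integral form of the logarithmic mean (a - b) / (ln a - ln b). *)
Definition logmean a b : R :=
  \int[lebesgue_measure]_(s in `[0%R, 1%R]) (a `^ (1 - s) * b `^ s).

Lemma geodesic_continuous a b : 0 < a -> 0 < b ->
  continuous (fun s : R => a `^ (1 - s) * b `^ s).
Proof.
have cexp (h : R -> R) : continuous h -> continuous (expR \o h).
  by move=> ch s; apply: continuous_comp; [exact: ch|exact: continuous_expR].
have cmul (h k : R -> R) : continuous h -> continuous k -> continuous (h \* k).
  by move=> ch ck s; apply: continuousM; [exact: ch|exact: ck].
have cst (k : R) : continuous (fun _ : R => k) by move=> s; exact: cvg_cst.
have cid : continuous (@idfun R) by move=> s; exact: cvg_id.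
move=> a0 b0; rewrite (_ : (fun s => _) =
    (expR \o ((fun s => 1 - s) \* (fun=> ln a))) \*
    (expR \o (idfun \* (fun=> ln b)))).
  apply: (cmul); apply: (cexp); apply: (cmul) => //.
  by move=> s; apply: continuousB; [exact: cst|exact: cid].
by apply/funext => s; rewrite /= /powR !gt_eqF.
Qed.

Lemma powR_le1 a (t : R) : 0 <= a <= 1 -> 0 <= t -> a `^ t <= 1.
Proof.
move=> /andP[a0 a1] t0; have <- : (1 : R) `^ t = 1 by rewrite powR1.
by apply: ge0_ler_powR; rewrite // ?nnegrE.
Qed.

(** For a <= b write b ^ t = a ^ t (b / a) ^ t; as b / a >= 1 and t <= 1, the last
factor is at most b / a, so the difference is at most a ^ t (b - a) / a. *)
Lemma powR_lipschitz (delta : R) a b (t : R) : 0 < delta ->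
  delta <= a <= 1 -> delta <= b <= 1 -> 0 <= t <= 1 ->
  `|a `^ t - b `^ t| <= delta^-1 * `|a - b|.
Proof.
move=> d0; wlog ab : a b / a <= b.
  move=> H da db t01; case: (leP a b) => [ab|/ltW ba]; first exact: H.
  by rewrite distrC (distrC a); exact: H.
move=> /andP[da a1] /andP[db b1] /andP[t0 t1].
have a0 : 0 < a := lt_le_trans d0 da.
have b0 : 0 < b := lt_le_trans d0 db.
rewrite distrC (distrC a) !ger0_norm ?subr_ge0 //; last first.
  by apply: ge0_ler_powR; rewrite // ?nnegrE ltW.
have -> : b `^ t = a `^ t * (b / a) `^ t.
  by rewrite -powRM ?divr_ge0 ?ltW // mulrCA divff ?mulr1 ?gt_eqF.
have ba1 : 1 <= b / a by rewrite ler_pdivlMr // mul1r.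
have : (b / a) `^ t <= b / a.
  by rewrite -[leRHS]powRr1 ?ler_powR // (le_trans ler01).
move=> le_ba; apply: (@le_trans _ _ (a `^ t * (b / a - 1))).
  by rewrite mulrBr mulr1 lerB // ler_wpM2l ?powR_ge0.
rewrite -[X in _ - X](divff (lt0r_neq0 a0)) -mulrBl mulrCA mulrC.
rewrite ler_wpM2r ?subr_ge0 // mulrC -[leRHS]mulr1.
rewrite ler_pM ?invr_ge0 ?powR_ge0 ?(ltW a0) //.
  by rewrite lef_pV2 ?posrE.
by apply: powR_le1; rewrite ?(ltW a0).
Qed.

Lemma logmean_ge0 a b : 0 <= logmean a b.
Proof. by apply: Rintegral_ge0 => s _; rewrite mulr_ge0 ?powR_ge0. Qed.

Lemma logmean_le1 a b : 0 < a <= 1 -> 0 < b <= 1 -> logmean a b <= 1.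
Proof.
move=> /andP[a0 a1] /andP[b0 b1]; rewrite -[leRHS]Rintegral01_cst.
apply: le_Rintegral => //.
- exact/continuous_integrable01/geodesic_continuous.
- exact/continuous_integrable01/cst_continuous.
- move=> s; rewrite /= in_itv /= => /andP[s0 s1].
  by rewrite mulr_ile1 ?powR_ge0 ?powR_le1 ?subr_ge0 ?a1 ?b1 ?(ltW a0) ?(ltW b0).
Qed.

Lemma logmean_lipschitzl delta a a' b : 0 < delta ->
  delta <= a <= 1 -> delta <= a' <= 1 -> 0 < b <= 1 ->
  `|logmean a b - logmean a' b| <= delta^-1 * `|a - a'|.
Proof.
move=> d0 ha ha' /andP[b0 b1].
have pos x : delta <= x <= 1 -> 0 < x by move=> /andP[/(lt_le_trans d0)].
apply: Rintegral01_dist; try by apply: geodesic_continuous => //; exact: pos.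
move=> s /andP[s0 s1]; rewrite -mulrBl normrM (ger0_norm (powR_ge0 _ _)).
rewrite -[leRHS]mulr1 ler_pM ?powR_ge0 ?powR_le1 ?(ltW b0) ?b1 //.
by rewrite powR_lipschitz // subr_ge0 s1 lerBlDr lerDl.
Qed.

Lemma logmean_lipschitzr delta a b b' : 0 < delta ->
  delta <= b <= 1 -> delta <= b' <= 1 -> 0 < a <= 1 ->
  `|logmean a b - logmean a b'| <= delta^-1 * `|b - b'|.
Proof.
move=> d0 hb hb' /andP[a0 a1].
have pos x : delta <= x <= 1 -> 0 < x by move=> /andP[/(lt_le_trans d0)].
apply: Rintegral01_dist; try by apply: geodesic_continuous => //; exact: pos.
move=> s /andP[s0 s1]; rewrite -mulrBr normrM (ger0_norm (powR_ge0 _ _)) mulrC.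
rewrite -[leRHS]mulr1 ler_pM ?powR_ge0 ?powR_le1 ?(ltW a0) ?a1 ?subr_ge0 //.
by rewrite powR_lipschitz // s0.
Qed.

End LogarithmicMean.

(** * The entry-sum norm and the spectrum of a density matrix *)

Section EntrySumNorm.
Context {R : realType}.

(** The sum of the moduli of the entries is submultiplicative and bounded on
unitary matrices, which is all that is required of a norm here; it takes values
in R[i], where the library puts the modulus. *)
Definition nrm m n (X : 'M[R[i]]_(m, n)) : R[i] := \sum_j \sum_k `|X j k|.

Lemma nrm_ge0 m n (X : 'M[R[i]]_(m, n)) : 0 <= nrm X.
Proof. by apply: sumr_ge0 => j _; apply: sumr_ge0. Qed.

Lemma nrm_le m n (X Y : 'M[R[i]]_(m, n)) :
  (forall j k, `|X j k| <= `|Y j k|) -> nrm X <= nrm Y.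
Proof. by move=> h; apply: ler_sum => j _; apply: ler_sum => k _. Qed.

Lemma entry_le_nrm m n (X : 'M[R[i]]_(m, n)) j k : `|X j k| <= nrm X.
Proof.
rewrite /nrm (bigD1 j) //= (bigD1 k) //= -addrA lerDl addr_ge0 ?sumr_ge0 //.
by move=> ? _; rewrite sumr_ge0.
Qed.

Lemma nrmD m n (X Y : 'M[R[i]]_(m, n)) : nrm (X + Y) <= nrm X + nrm Y.
Proof.
rewrite -big_split; apply: ler_sum => j _; rewrite -big_split.
by apply: ler_sum => k _; rewrite mxE ler_normD.
Qed.

Lemma nrmN m n (X : 'M[R[i]]_(m, n)) : nrm (- X) = nrm X.
Proof. by do 2![apply: eq_bigr => ? _]; rewrite mxE normrN. Qed.

Lemma nrmB m n (X Y : 'M[R[i]]_(m, n)) : nrm (X - Y) <= nrm X + nrm Y.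
Proof. by rewrite -[nrm Y]nrmN nrmD. Qed.

Lemma nrmZ m n a (X : 'M[R[i]]_(m, n)) : nrm (a *: X) = `|a| * nrm X.
Proof.
rewrite mulr_sumr; apply: eq_bigr => j _; rewrite mulr_sumr.
by apply: eq_bigr => k _; rewrite mxE normrM.
Qed.

Lemma nrm_sum m n (I : Type) (r : seq I) (p : pred I) (F : I -> 'M[R[i]]_(m, n)) :
  nrm (\sum_(a <- r | p a) F a) <= \sum_(a <- r | p a) nrm (F a).
Proof.
elim/big_rec2: _ => [|a y x _ le_xy]; last by rewrite (le_trans (nrmD _ _)) ?lerD2l.
by rewrite /nrm big1 // => j _; rewrite big1 // => k _; rewrite mxE normr0.
Qed.

(** The form of submultiplicativity that survives entrywise weights: E is
dominated by the product of the moduli, without being a matrix product. *)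
Lemma nrm_le_conv m n p (E : 'M[R[i]]_(m, p)) (A : 'M[R[i]]_(m, n)) (B : 'M[R[i]]_(n, p)) :
  (forall j k, `|E j k| <= \sum_l `|A j l| * `|B l k|) -> nrm E <= nrm A * nrm B.
Proof.
move=> h; apply: (@le_trans _ _ (\sum_j \sum_k \sum_l `|A j l| * `|B l k|)).
  by apply: ler_sum => j _; apply: ler_sum.
rewrite mulr_suml; apply: ler_sum => j _; rewrite exchange_big mulr_suml /=.
apply: ler_sum => l _; rewrite -mulr_sumr ler_wpM2l // /nrm (bigD1 l) //= lerDl.
by rewrite sumr_ge0 // => ? _; rewrite sumr_ge0.
Qed.

Lemma nrmM m n p (A : 'M[R[i]]_(m, n)) (B : 'M[R[i]]_(n, p)) :
  nrm (A *m B) <= nrm A * nrm B.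
Proof.
apply: nrm_le_conv => j k; rewrite mxE (le_trans (ler_norm_sum _ _ _)) //.
by apply: ler_sum => l _; rewrite normrM.
Qed.

Lemma nrm_tr n (A : 'M[R[i]]_n) : `|\tr A| <= nrm A.
Proof.
rewrite (le_trans (ler_norm_sum _ _ _)) //; apply: ler_sum => j _.
by rewrite (bigD1 j) //= lerDl sumr_ge0.
Qed.

Lemma nrm_unitary c (Q : 'M[R[i]]_c) : Q \is unitarymx -> nrm Q <= (c * c)%:R.
Proof.
move=> /unitarymxP uQ.
suff h j k : `|Q j k| <= 1.
  rewrite (le_trans (ler_sum _ (fun j _ => ler_sum _ (fun k _ => h j k)))) //.
  by rewrite !sumr_const card_ord -mulrnA.
rewrite -[leRHS]normr1 -ler_sqr ?nnegrE // normr1 expr1n.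
have /(congr1 (fun M : 'M[R[i]]_c => M j j)) := uQ; rewrite !mxE eqxx mulr1n => <-.
rewrite (bigD1 k) //= !mxE -normCK lerDl sumr_ge0 // => l _.
by rewrite !mxE -normCK exprn_ge0.
Qed.

End EntrySumNorm.

Section Spectrum.
Context {R : realType} {c : nat} (rho : 'M[R[i]]_c).
Hypothesis hrho : density rho.
Local Notation Q := (spectralmx rho).

Definition eigval j : R := complex.Re (spectral_diag rho 0 j).

Lemma spectralmx_mul_ctr : Q *m Q^t* = 1%:M.
Proof. exact/unitarymxP/spectral_unitarymx. Qed.

Lemma spectralmx_ctr_mul : Q^t* *m Q = 1%:M.
Proof. exact: mulmx1C spectralmx_mul_ctr. Qed.

Lemma spectral_decomposition :
  rho = Q^t* *m diag_mx (spectral_diag rho) *m Q.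
Proof.
have [/hermitian_normalmx/orthomx_spectralP E _ _] := hrho.
by rewrite -invmx_unitary ?spectral_unitarymx.
Qed.

Lemma spectral_conj : Q *m rho *m Q^t* = diag_mx (spectral_diag rho).
Proof.
rewrite {2}spectral_decomposition !mulmxA spectralmx_mul_ctr mul1mx -mulmxA.
by rewrite spectralmx_mul_ctr mulmx1.
Qed.

(** Testing positive definiteness on the j-th eigenvector, which is the j-th
column of Q^t*; positivity in R[i] also makes the eigenvalue real. *)
Lemma spectral_diag_gt0 j : 0 < spectral_diag rho 0 j.
Proof.
have [_ pd _] := hrho; have := pd (Q^t* *m delta_mx j 0).
rewrite ctrM trmxCK !mulmxA -(mulmxA _ Q) -(mulmxA _ _ (Q^t*)) spectral_conj.
have -> : (delta_mx j 0 : 'cV[R[i]]_c)^t* = delta_mx 0 j.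
  by apply/matrixP => a b; rewrite !mxE conjC_nat andbC.
rewrite -rowE mxE (bigD1 j) //= big1 ?addr0; last first.
  by move=> k kj; rewrite !mxE (negPf kj) mulr0.
rewrite !mxE !eqxx mulr1n mulr1; apply.
apply/eqP => /(congr1 (mulmx Q)); rewrite mulmxA spectralmx_mul_ctr mul1mx mulmx0.
by move=> /matrixP/(_ j 0)/eqP; rewrite !mxE !eqxx oner_eq0.
Qed.

Lemma spectral_diagE j : spectral_diag rho 0 j = (eigval j)%:C.
Proof. by rewrite RRe_real // gtr0_real // spectral_diag_gt0. Qed.

Lemma eigval_gt0 j : 0 < eigval j.
Proof. by rewrite -ltcR -spectral_diagE spectral_diag_gt0. Qed.

Lemma eigval_sum : \sum_j eigval j = 1.
Proof.
apply: complexI; rewrite rmorph_sum rmorph1; have [_ _ <-] := hrho.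
rewrite [in RHS]spectral_decomposition mxtrace_mulC mulmxA spectralmx_mul_ctr mul1mx.
by rewrite mxtrace_diag; apply: eq_bigr => j _; rewrite spectral_diagE.
Qed.

Lemma eigval_le1 j : eigval j <= 1.
Proof.
rewrite -eigval_sum (bigD1 j) //= lerDl sumr_ge0 // => k _.
exact/ltW/eigval_gt0.
Qed.

Lemma density_det : \det rho = (\prod_j eigval j)%:C.
Proof.
rewrite spectral_decomposition !det_mulmx mulrAC -det_mulmx spectralmx_ctr_mul.
rewrite det1 mul1r det_diag rmorph_prod.
by apply: eq_bigr => j _; rewrite spectral_diagE.
Qed.

Lemma density_det_gt0 : 0 < complex.Re (\det rho).
Proof. by rewrite density_det /= prodr_gt0 // => j _; exact: eigval_gt0. Qed.

(** The other eigenvalues are at most 1, so the determinant, a continuous function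
of the matrix, serves as a lower bound for the spectrum. *)
Lemma det_le_eigval j : complex.Re (\det rho) <= eigval j.
Proof.
rewrite density_det /= (bigD1 j) //= -[leRHS]mulr1 ler_wpM2l //.
  exact/ltW/eigval_gt0.
by apply: prodr_ile1 => k _; rewrite eigval_le1 ltW ?eigval_gt0.
Qed.

Lemma nrm_density : nrm rho <= (c * c)%:R ^+ 2.
Proof.
rewrite {1}spectral_decomposition (le_trans (nrmM _ _)) // expr2.
rewrite ler_pM ?nrm_ge0 //; last exact/nrm_unitary/spectral_unitarymx.
rewrite (le_trans (nrmM _ _)) // -[leRHS]mulr1 ler_pM ?nrm_ge0 //.
  by rewrite nrm_unitary // trmxC_unitary spectral_unitarymx.
rewrite -[leRHS]/((1 : R)%:C) -eigval_sum rmorph_sum; apply: ler_sum => j _.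
rewrite (bigD1 j) //= big1 ?addr0; last first.
  by move=> k kj; rewrite mxE eq_sym (negPf kj) normr0.
by rewrite mxE eqxx mulr1n spectral_diagE ger0_norm // ler0c ltW ?eigval_gt0.
Qed.

Lemma mxpow_density s :
  mxpow rho s = Q^t* *m diag_mx (\row_j (eigval j `^ s)%:C) *m Q.
Proof.
rewrite /mxpow (invmx_unitary (spectral_unitarymx rho)).
suff -> : map_mx (fun z : R[i] => (complex.Re z `^ s)%:C) (spectral_diag rho) =
    \row_j (eigval j `^ s)%:C by [].
by apply/rowP => j; rewrite !mxE.
Qed.

End Spectrum.

(** * Commutators and Schur multipliers *)

Section Schur.
Context {R : realType} {c : nat}.
Implicit Types (X A B : 'M[R[i]]_c) (m : 'I_c -> 'I_c -> R).

Definition schur m X : 'M[R[i]]_c := \matrix_(j, k) ((m j k)%:C * X j k).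

Lemma schur_entry m A B X j k :
  (A *m schur m X *m B) j k =
  \sum_b \sum_a (m a b)%:C * (A j a * X a b * B b k).
Proof.
rewrite mxE; apply: eq_bigr => b _; rewrite mxE mulr_suml; apply: eq_bigr => a _.
by rewrite mxE mulrCA !mulrA.
Qed.

(** Entrywise integration of a matrix with real weights m a b s integrates only
the weights, by linearity in the fixed complex coefficients. *)
Lemma mxintegral01_schur (m : 'I_c -> 'I_c -> R -> R) A B X :
  (forall a b, continuous (m a b)) ->
  mxintegral01 (fun s => A *m schur (fun a b => m a b s) X *m B) =
  A *m schur (fun a b =>
    \int[lebesgue_measure]_(s in `[0%R, 1%R]) m a b s) X *m B.
Proof.
move=> cm; apply/matrixP => j k; rewrite mxE.
have cterm (w : 'I_c -> 'I_c -> R) b a : continuous (fun s => m a b s * w a b).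
  by move=> s; apply: cvgM; [exact: cm|exact: cvg_cst].
have lin (w : 'I_c -> 'I_c -> R) :
  \int[lebesgue_measure]_(s in `[0%R, 1%R]) (\sum_b \sum_a m a b s * w a b) =
  \sum_b \sum_a \int[lebesgue_measure]_(s in `[0%R, 1%R]) m a b s * w a b.
  rewrite (@Rintegral01_sum _ _ _ (fun b s => \sum_a m a b s * w a b)); last first.
    by move=> b; apply: continuous_bigsum.
  apply: eq_bigr => b _; rewrite (@Rintegral01_sum _ _ _ (fun a s => m a b s * w a b)) //.
  by apply: eq_bigr => a _; rewrite RintegralZr //; exact: continuous_integrable01.
rewrite schur_entry; apply/eqP; rewrite eq_complex /=; apply/andP; split; apply/eqP.
  under eq_Rintegral => s _.
    rewrite schur_entry Re_sum; under eq_bigr do rewrite Re_sum.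
    under eq_bigr do under eq_bigr do rewrite Re_scale.
    over.
  rewrite (lin (fun a b => complex.Re (A j a * X a b * B b k))) Re_sum.
  apply: eq_bigr => b _; rewrite Re_sum; apply: eq_bigr => a _.
  by rewrite Re_scale.
under eq_Rintegral => s _.
  rewrite schur_entry Im_sum; under eq_bigr do rewrite Im_sum.
  under eq_bigr do under eq_bigr do rewrite Im_scale.
  over.
rewrite (lin (fun a b => complex.Im (A j a * X a b * B b k))) Im_sum.
apply: eq_bigr => b _; rewrite Im_sum; apply: eq_bigr => a _.
by rewrite Im_scale.
Qed.

End Schur.

Section Commutators.
Context {R : realType} {c : nat}.
Implicit Types (K X A B Q rho : 'M[R[i]]_c).

Definition lie K X := K *m X - X *m K.

(** In an eigenbasis of rho the (j, k) entry of rho ^ (1 - s) X rho ^ s is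
d_j ^ (1 - s) d_k ^ s X_jk, and integrating over s gives the logarithmic mean of
the eigenvalues d_j and d_k. *)
Lemma Tinv_schur rho X : density rho ->
  Tinv rho X = (spectralmx rho)^t* *m
    schur (fun j k => logmean (eigval rho j) (eigval rho k))
      (spectralmx rho *m X *m (spectralmx rho)^t*) *m spectralmx rho.
Proof.
move=> hrho.
rewrite -(@mxintegral01_schur _ _
  (fun j k s => eigval rho j `^ (1 - s) * eigval rho k `^ s)); last first.
  by move=> j k; apply: geodesic_continuous; exact: eigval_gt0.
congr mxintegral01; apply/funext => s; rewrite !mxpow_density // !mulmxA.
congr (_ *m _); rewrite -!mulmxA; congr (_ *m _); rewrite !mulmxA.
apply/matrixP => j k; rewrite mul_mx_diag -!mulmxA mul_diag_mx !mxE.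
by rewrite rmorphM /= mulrAC.
Qed.

Lemma lie_unconj Q K A : Q *m Q^t* = 1%:M ->
  lie K (Q^t* *m A *m Q) = Q^t* *m lie (Q *m K *m Q^t*) A *m Q.
Proof.
move=> QQ; have QQ' := mulmx1C QQ.
rewrite /lie mulmxBr mulmxBl !mulmxA QQ' mul1mx -!mulmxA QQ' mulmx1.
by rewrite !mulmxA.
Qed.

Lemma lie_conj Q K A : Q *m Q^t* = 1%:M ->
  lie (Q *m K *m Q^t*) (Q *m A *m Q^t*) = Q *m lie K A *m Q^t*.
Proof.
move=> QQ; have QQ' := mulmx1C QQ.
rewrite /lie mulmxBr mulmxBl -!mulmxA.
by rewrite !(mulmxA (Q^t*) Q) QQ' !mul1mx.
Qed.

Lemma nrm_unitary_conj Q A : Q *m Q^t* = 1%:M ->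
  nrm (Q *m A *m Q^t*) <= (c * c)%:R ^+ 2 * nrm A.
Proof.
move=> QQ; have uQ : Q \is unitarymx by apply/unitarymxP.
rewrite (le_trans (nrmM _ _)) // expr2 -mulrA mulrC ler_pM ?nrm_ge0 //.
  by apply: nrm_unitary; rewrite trmxC_unitary.
by rewrite (le_trans (nrmM _ _)) // ler_wpM2r ?nrm_ge0 ?nrm_unitary.
Qed.

Lemma nrm_unitary_unconj Q A : Q *m Q^t* = 1%:M ->
  nrm (Q^t* *m A *m Q) <= (c * c)%:R ^+ 2 * nrm A.
Proof.
move=> QQ; have := @nrm_unitary_conj (Q^t*) A; rewrite trmxCK; apply.
exact: mulmx1C.
Qed.

(** Let D be the diagonal matrix of the d_j.  Moving ad K inside the Schur product
replaces m_ak by m_jk under the sums, and the error terms contain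
K_ja (m_ak - m_jk).  The Lipschitz bound turns this into a multiple of
|K_ja (d_a - d_j)|, which is the modulus of an entry of [K, D].  Thus K itself
does not appear on the right, only its commutators with X and D. *)
Lemma nrm_lie_schur (m : 'I_c -> 'I_c -> R) (d : 'I_c -> R) (L : R) K X :
  0 <= L ->
  (forall j k, 0 <= m j k <= 1) ->
  (forall j j' k, `|m j k - m j' k| <= L * `|d j - d j'|) ->
  (forall j k k', `|m j k - m j k'| <= L * `|d k - d k'|) ->
  nrm (lie K (schur m X)) <=
  nrm (lie K X) + 2%:R * L%:C * nrm (lie K (diag_mx (\row_j (d j)%:C))) * nrm X.
Proof.
move=> L0 m01 lipl lipr; set D := diag_mx _.
(* E1 and E2 collect the errors made at the left and at the right index of m. *)
pose E1 : 'M[R[i]]_c := \matrix_(j, k) \sum_a K j a * (m a k - m j k)%:C * X a k.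
pose E2 : 'M[R[i]]_c := \matrix_(j, k) \sum_a X j a * (m j a - m j k)%:C * K a k.
have -> : lie K (schur m X) = schur m (lie K X) + (E1 - E2).
  apply/matrixP => j k; rewrite !mxE mulrBr !mulr_sumr addrACA -opprD -!big_split /=.
  congr (_ - _); apply: eq_bigr => a _; rewrite mxE rmorphB /=.
    by ring.
  by ring.
have le1 : nrm (schur m (lie K X)) <= nrm (lie K X).
  apply: nrm_le => j k; rewrite mxE normrM -[leRHS]mul1r ler_wpM2r //.
  by have /andP[m0 m1] := m01 j k; rewrite ger0_norm ?ler0c // (lecR _ 1).
have normC (x : R) : `|x%:C| = `|x|%:C.
  by rewrite normc_def /= expr0n addr0 sqrtr_sqr.
have cD a b : `|lie K D a b| = `|K a b| * `|d b - d a|%:C.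
  rewrite !mxE; rewrite /D.
  have := mul_mx_diag K (\row_j (d j)%:C) => /matrixP/(_ a b); rewrite !mxE => ->.
  have := mul_diag_mx (\row_j (d j)%:C) K => /matrixP/(_ a b); rewrite !mxE => ->.
  by rewrite mulrC -mulrBl -rmorphB normrM normC mulrC.
have le2 : nrm E1 <= nrm (L%:C *: lie K D) * nrm X.
  apply: nrm_le_conv => j k; rewrite mxE (le_trans (ler_norm_sum _ _ _)) //.
  apply: ler_sum => a _; rewrite !normrM mxE normrM cD !normC (ger0_norm L0).
  rewrite ler_wpM2r // mulrCA ler_wpM2l // -rmorphM lecR; exact: lipl.
have le3 : nrm E2 <= nrm X * nrm (L%:C *: lie K D).
  apply: nrm_le_conv => j k; rewrite mxE (le_trans (ler_norm_sum _ _ _)) //.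
  apply: ler_sum => a _; rewrite !normrM mxE normrM cD !normC (ger0_norm L0).
  rewrite -mulrA ler_wpM2l // mulrCA [leLHS]mulrC ler_wpM2l // -rmorphM lecR.
  by rewrite (distrC (d k)); exact: lipr.
rewrite (le_trans (nrmD _ _)) // lerD // (le_trans (nrmB _ _)) //.
rewrite (le_trans (lerD le2 le3)) // nrmZ normC (ger0_norm L0).
by rewrite le_eqVlt; apply/orP; left; apply/eqP; ring.
Qed.

End Commutators.

(** * Commutator estimate for the quantum replicator *)

Section ReplicatorCommutator.
Context {R : realType} {c : nat}.
Implicit Types (K X rho : 'M[R[i]]_c).
Local Notation kappa := ((c * c)%:R : R[i]).

Lemma lieB K X Y : lie K (X - Y) = lie K X - lie K Y.
Proof. by rewrite /lie mulmxBr mulmxBl !opprB [X in _ + X = _]addrC addrACA [X in _ + X = _]addrC. Qed.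

Lemma lieZ K a X : lie K (a *: X) = a *: lie K X.
Proof. by rewrite /lie -scalemxAr -scalemxAl scalerBr. Qed.

Lemma lie_sum K (I : Type) (r : seq I) (p : pred I) (F : I -> 'M[R[i]]_c) :
  lie K (\sum_(a <- r | p a) F a) = \sum_(a <- r | p a) lie K (F a).
Proof. by rewrite /lie mulmx_sumr mulmx_suml sumrB. Qed.

(** [nrm_lie_schur] in an eigenbasis of rho, where D is the conjugate of rho; the
logarithmic mean has Lipschitz constant 1 / delta on [delta, 1].  Each conjugation
by a unitary matrix costs a factor kappa ^+ 2. *)
Lemma nrm_lie_Tinv (delta : R) K X rho : density rho ->
  0 < delta -> delta <= complex.Re (\det rho) ->
  nrm (lie K (Tinv rho X)) <=
  kappa ^+ 2 * (kappa ^+ 2 * nrm (lie K X) +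
    2%:R * (delta^-1)%:C * (kappa ^+ 2 * nrm (lie K rho)) * (kappa ^+ 2 * nrm X)).
Proof.
move=> hrho d0 dd; have QQ := spectralmx_mul_ctr rho.
have ev j : delta <= eigval rho j <= 1.
  by rewrite (le_trans dd (det_le_eigval hrho j)) eigval_le1.
have ev0 j : 0 < eigval rho j <= 1 by rewrite eigval_gt0 // eigval_le1.
rewrite Tinv_schur // lie_unconj // (le_trans (nrm_unitary_unconj _ QQ)) //.
rewrite ler_wpM2l ?exprn_ge0 // ?ler0n //.
have L0 : 0 <= delta^-1 by rewrite invr_ge0 ltW.
have m01 j k : 0 <= logmean (eigval rho j) (eigval rho k) <= 1.
  by rewrite logmean_ge0 logmean_le1.
apply: le_trans (nrm_lie_schur _ _ L0 m01 (d := eigval rho) _ _) _.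
- by move=> j j' k; apply: logmean_lipschitzl.
- by move=> j k k'; apply: logmean_lipschitzr.
have -> : diag_mx (\row_j (eigval rho j)%:C) =
    spectralmx rho *m rho *m (spectralmx rho)^t*.
  rewrite spectral_conj //; congr diag_mx; apply/rowP => j.
  by rewrite mxE spectral_diagE.
rewrite !lie_conj // lerD ?nrm_unitary_conj //.
by rewrite ler_pM ?mulr_ge0 ?ler0n ?nrm_ge0 ?ler_wpM2l ?mulr_ge0 ?ler0n ?ler0c ?nrm_unitary_conj.
Qed.

(** The closed linear estimate behind the Gronwall argument.  The constant depends
on delta and the dimension but not on K, and the right-hand side involves all
vertices because the graph couples them. *)
Lemma replicator_lie_bound (V : finType) (G : wgraph R V) (delta : R) :
  0 < delta -> exists2 L : R, 0 <= L &
  forall (mu : V -> 'M[R[i]]_c) K, Qmanifold mu ->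
    (forall i, delta <= complex.Re (\det (mu i))) ->
    forall i, nrm (lie K (qreplicators mu (similarity G mu) i)) <=
      L%:C * \sum_k nrm (lie K (mu k)).
Proof.
(* Naming kappa ^+ 2 abstractly keeps rmorphM from splitting (c * c)%:R. *)
move=> d0; have [kk kkE] : exists kk : R[i], kk = kappa ^+ 2 by eexists.
have [k2 k20 k2C] : exists2 k2 : R, 0 <= k2 & k2%:C = kk.
  by exists ((c * c)%:R ^+ 2); rewrite ?exprn_ge0 // kkE rmorphXn /= rmorph_nat.
exists (k2 * (k2 + 2%:R * delta^-1 * k2 * (k2 * k2)) + k2 * k2).
  by rewrite !(addr_ge0, mulr_ge0) ?invr_ge0 ?(ltW d0).
move=> mu K hmu dmu i.
set N := \sum_k _.
have N0 : 0 <= N by apply: sumr_ge0 => k _; exact: nrm_ge0.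
have leN k : nrm (lie K (mu k)) <= N.
  by rewrite /N (bigD1 k) //= lerDl sumr_ge0 // => ? _; exact: nrm_ge0.
pose w := weight G i.
have w0 k : 0 <= w k := weight_ge0 G i k.
have w1 : \sum_(k in nbhood (edge G) i) w k = 1 := weight_sum1 G i.
have normw k : `|(w k)%:C| = (w k)%:C by rewrite ger0_norm // ler0c.
set X := similarity G mu i.
have XE : X = \sum_(k in nbhood (edge G) i) (w k)%:C *: mu k by [].
have avg (f : V -> R[i]) (M : R[i]) : (forall k, f k <= M) ->
    \sum_(k in nbhood (edge G) i) `|(w k)%:C| * f k <= M.
  move=> fM; rewrite -[leRHS]mul1r -[1]/((1 : R)%:C) -w1 rmorph_sum mulr_suml.
  by apply: ler_sum => k _; rewrite normw ler_wpM2l // ler0c.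
have nX : nrm X <= kk.
  rewrite kkE XE (le_trans (nrm_sum _ _ _)) //; under eq_bigr do rewrite nrmZ.
  by apply: avg => k; exact: nrm_density.
have cX : nrm (lie K X) <= N.
  rewrite XE lie_sum (le_trans (nrm_sum _ _ _)) //.
  by under eq_bigr do rewrite lieZ nrmZ; exact: avg.
rewrite /qreplicators -/X /qreplicator lieB lieZ (le_trans (nrmB _ _)) //.
rewrite nrmZ rmorphD mulrDl lerD //.
  have := nrm_lie_Tinv K X (hmu i) d0 (dmu i); rewrite -kkE => /le_trans; apply.
  rewrite !rmorphM /= rmorphD /= !rmorphM /= rmorph_nat !k2C.
  have k0 : 0 <= kk by rewrite kkE exprn_ge0 ?ler0n.
  have di0 : 0 <= (delta^-1)%:C :> R[i] by rewrite ler0c invr_ge0 ltW.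
  rewrite -[leRHS]mulrA. rewrite ler_wpM2l // [leRHS]mulrDl lerD ?ler_wpM2l //.
  rewrite (_ : _ * N = 2%:R * (delta^-1)%:C * (kk * N) * (kk * kk)).
    have c0 : 0 <= 2%:R * (delta^-1)%:C :> R[i] by rewrite mulr_ge0 ?ler0n.
    by rewrite ler_pM ?mulr_ge0 ?nrm_ge0 ?ler_wpM2l.
  by ring.
rewrite rmorphM /= k2C ler_pM ?nrm_ge0 //.
rewrite (le_trans (nrm_tr _)) // (le_trans (nrmM _ _)) //.
by rewrite ler_pM ?nrm_ge0 // kkE nrm_density.
Qed.

End ReplicatorCommutator.

(** * A Gronwall argument for finite families *)

Section Gronwall.
Context {R : realType}.

Lemma is_derive_bigsum (T : Type) (r : seq T) (f : T -> R -> R) (df : T -> R) (t : R) :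
  (forall a, is_derive t 1 (f a) (df a)) ->
  is_derive t 1 (fun s => \sum_(a <- r) f a s) (\sum_(a <- r) df a).
Proof.
move=> h; elim: r => [|a r IH].
  by rewrite big_nil; under eq_fun do rewrite big_nil; exact: is_derive_cst.
by rewrite big_cons; under eq_fun do rewrite big_cons; exact: is_deriveD.
Qed.

(** With phi the sum of the squares of the y_n, the bound gives |phi'| <= C phi.
Then exp (- C t) phi is nonincreasing and exp (C t) phi is nondecreasing, so a
zero of phi at either endpoint forces one at the other.  The growth hypothesis is
phrased with a common bound M of the |y_n|, and it is used with M = sqrt phi. *)
Lemma gronwall_zero (I : finType) (y dy : I -> R -> R) (a b L : R) :
  a <= b -> 0 <= L ->
  (forall n, {within `[a, b], continuous (y n)}) ->
  (forall t, t \in `]a, b[ -> forall n, is_derive t 1 (y n) (dy n t)) ->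
  (forall t, t \in `]a, b[ -> forall M : R, (forall n, `|y n t| <= M) ->
     forall n, `|dy n t| <= L * M) ->
  (forall n, y n a = 0) <-> (forall n, y n b = 0).
Proof.
move=> ab L0 cy dyy bnd.
pose phi t := \sum_n y n t ^+ 2.
pose dphi t := \sum_n y n t * dy n t *+ 2.
pose C := #|I|%:R * L *+ 2.
have phi_ge0 t : 0 <= phi t by apply: sumr_ge0 => n _; exact: sqr_ge0.
have phi0 t : (forall n, y n t = 0) <-> phi t = 0.
  split=> [h|/eqP]; first by rewrite /phi big1 // => n _; rewrite h expr0n.
  rewrite psumr_eq0 => [/allP h n|n _]; last exact: sqr_ge0.
  by apply/eqP; rewrite -sqrf_eq0; exact: h (mem_index_enum n).
have dphiP t : t \in `]a, b[ -> is_derive t 1 phi (dphi t).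
  move=> tab; apply: is_derive_bigsum => n.
  have := dyy t tab n; move=> h.
  have -> : (fun s => y n s ^+ 2) = y n * y n by apply/funext => s; rewrite expr2.
  by apply: is_derive_eq; rewrite mulr2n.
have dphi_le t : t \in `]a, b[ -> `|dphi t| <= C * phi t.
  move=> tab; set M := Num.sqrt (phi t).
  have yM n : `|y n t| <= M.
    rewrite -sqrtr_sqr ler_wsqrtr // /phi (bigD1 n) //= lerDl sumr_ge0 // => k _.
    exact: sqr_ge0.
  have MM : M * M = phi t by rewrite -expr2 sqr_sqrtr.
  rewrite (le_trans (ler_norm_sum _ _ _)) //.
  apply: (@le_trans _ _ (\sum_(n : I) L * phi t *+ 2)).
    apply: ler_sum => n _; rewrite normrMn lerMn2r /= normrM -MM mulrCA.
    by rewrite ler_pM // bnd.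
  by rewrite sumr_const -mulr_natl /C le_eqVlt; apply/orP; left; apply/eqP; ring.
have cphi : {within `[a, b], continuous phi}.
  apply: continuous_bigsum => n.
  rewrite (_ : (fun s => _) = y n \* y n) => [s|].
    by apply: cvgM; exact: cy.
  by apply/funext => s /=; rewrite expr2.
move: ab; rewrite le_eqVlt => /predU1P[<-//|ab].
have mvt (k : R) : exists2 c, c \in `]a, b[ &
    expR (k * b) * phi b - expR (k * a) * phi a =
    expR (k * c) * (dphi c + k * phi c) * (b - a).
  have dexp (t : R) : is_derive t 1 (fun s : R => expR (k * s)) (expR (k * t) * k).
    have kid : is_derive t 1 (fun s : R => k * s) k.
      by apply: (@is_derive_eq _ _ _ (k \*: (@id R))); rewrite /GRing.scale /= mulr1.
    exact: (@is_derive1_comp _ expR (fun s => k * s)).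
  apply: (@MVT _ (fun s => expR (k * s) * phi s)
           (fun s => expR (k * s) * (dphi s + k * phi s))) => //.
    move=> t tab; have := dphiP t tab => dp; have := dexp t => de.
    apply: (is_derive_eq (is_deriveM de dp)).
    by rewrite /GRing.scale /=; ring.
  move=> s; apply: cvgM; last exact: cphi.
  apply: continuous_subspaceT => t; apply: differentiable_continuous.
  by apply/derivable1_diffP; case: (dexp t).
rewrite !phi0; split=> h.
- have [c cab] := mvt (- C); rewrite h mulr0 subr0 => e.
  have : expR (- C * b) * phi b <= 0.
    rewrite e mulr_le0_ge0 ?subr_ge0 ?(ltW ab) // mulr_ge0_le0 ?expR_ge0 //.
    rewrite mulNr subr_le0.
    by have := dphi_le c cab; rewrite ler_norml => /andP[].
  by rewrite pmulr_rle0 ?expR_gt0 // => ?; apply/eqP; rewrite eq_le phi_ge0 andbT.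
- have [c cab] := mvt C; rewrite h mulr0 sub0r => e.
  have : expR (C * a) * phi a <= 0.
    rewrite -oppr_ge0 e mulr_ge0 ?subr_ge0 ?(ltW ab) // mulr_ge0 ?expR_ge0 //.
    rewrite addrC -lerBlDl sub0r.
    by have := dphi_le c cab; rewrite ler_norml => /andP[].
  by rewrite pmulr_rle0 ?expR_gt0 // => ?; apply/eqP; rewrite eq_le phi_ge0 andbT.
Qed.

End Gronwall.

(** * Complex-valued curves and the commutant *)

Section ComplexCurves.
Context {R : realType}.
Implicit Types f h : R -> R[i].

(** Differentiability and continuity of complex-valued curves are taken on real
and imaginary parts, the form in which curves of matrices are given. *)
Definition cderive f (t : R) (d : R[i]) : Prop :=
  is_derive t 1 (fun s => complex.Re (f s)) (complex.Re d) /\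
  is_derive t 1 (fun s => complex.Im (f s)) (complex.Im d).

Definition ccontinuous (J : set R) f : Prop :=
  {within J, continuous (fun s => complex.Re (f s))} /\
  {within J, continuous (fun s => complex.Im (f s))}.

Lemma cderive_cst (w : R[i]) t : cderive (fun=> w) t 0.
Proof. by split; exact: is_derive_cst. Qed.

Lemma cderiveD f h t d e : cderive f t d -> cderive h t e ->
  cderive (fun s => f s + h s) t (d + e).
Proof.
move=> [f1 f2] [h1 h2]; split.
  by rewrite ReD; under eq_fun do rewrite ReD; exact: is_deriveD.
by rewrite ImD; under eq_fun do rewrite ImD; exact: is_deriveD.
Qed.

Lemma cderiveZ (w : R[i]) f t d : cderive f t d ->
  cderive (fun s => w * f s) t (w * d).
Proof.
move=> [f1 f2]; have Z := fun k (u : R -> R) du (hu : is_derive t 1 u du) =>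
  @is_deriveZ R R R u k t 1 du hu.
split.
  rewrite ReM; under eq_fun do rewrite ReM.
  exact: (is_deriveB (Z _ _ _ f1) (Z _ _ _ f2)).
rewrite ImM; under eq_fun do rewrite ImM.
exact: (is_deriveD (Z _ _ _ f2) (Z _ _ _ f1)).
Qed.

Lemma cderive_sum (T : Type) (r : seq T) (F : T -> R -> R[i]) (d : T -> R[i]) t :
  (forall a, cderive (F a) t (d a)) ->
  cderive (fun s => \sum_(a <- r) F a s) t (\sum_(a <- r) d a).
Proof.
move=> h; elim: r => [|a r IH].
  by rewrite big_nil; under eq_fun do rewrite big_nil; exact: cderive_cst.
rewrite big_cons (_ : (fun s => _) = (fun s => F a s + \sum_(b <- r) F b s)).
  exact: cderiveD.
by apply/funext => s; rewrite big_cons.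
Qed.

Lemma cderiveB f h t d e : cderive f t d -> cderive h t e ->
  cderive (fun s => f s - h s) t (d - e).
Proof.
move=> cf /(cderiveZ (-1)) ch; have := cderiveD cf ch.
by rewrite mulN1r; under eq_fun do rewrite mulN1r.
Qed.

Lemma ccontinuous_cst J (w : R[i]) : ccontinuous J (fun=> w).
Proof. by split=> s; exact: cvg_cst. Qed.

Lemma ccontinuousD J f h : ccontinuous J f -> ccontinuous J h ->
  ccontinuous J (fun s => f s + h s).
Proof.
move=> [f1 f2] [h1 h2]; split.
  rewrite (_ : (fun s => _) = (fun s => complex.Re (f s) + complex.Re (h s))).
    by move=> s; apply: cvgD; [exact: f1|exact: h1].
  by apply/funext => s; rewrite ReD.
rewrite (_ : (fun s => _) = (fun s => complex.Im (f s) + complex.Im (h s))).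
  by move=> s; apply: cvgD; [exact: f2|exact: h2].
by apply/funext => s; rewrite ImD.
Qed.

Lemma ccontinuousM J f h : ccontinuous J f -> ccontinuous J h ->
  ccontinuous J (fun s => f s * h s).
Proof.
move=> [f1 f2] [h1 h2]; split.
  rewrite (_ : (fun s => _) = (fun s =>
    complex.Re (f s) * complex.Re (h s) - complex.Im (f s) * complex.Im (h s))).
    move=> s; apply: cvgB; apply: cvgM;
    by [exact: f1|exact: h1|exact: f2|exact: h2].
  by apply/funext => s; rewrite ReM.
rewrite (_ : (fun s => _) = (fun s =>
    complex.Re (f s) * complex.Im (h s) + complex.Im (f s) * complex.Re (h s))).
  move=> s; apply: cvgD; apply: cvgM;
  by [exact: f1|exact: h1|exact: f2|exact: h2].
by apply/funext => s; rewrite ImM.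
Qed.

Lemma ccontinuous_sum J (T : Type) (r : seq T) (F : T -> R -> R[i]) :
  (forall a, ccontinuous J (F a)) -> ccontinuous J (fun s => \sum_(a <- r) F a s).
Proof.
move=> h; elim: r => [|a r IH].
  rewrite (_ : (fun s => _) = (fun=> 0)); first exact: ccontinuous_cst.
  by apply/funext => s; rewrite big_nil.
rewrite (_ : (fun s => _) = (fun s => F a s + \sum_(b <- r) F b s)).
  exact: ccontinuousD.
by apply/funext => s; rewrite big_cons.
Qed.

Lemma ccontinuous_prod J (T : Type) (r : seq T) (F : T -> R -> R[i]) :
  (forall a, ccontinuous J (F a)) -> ccontinuous J (fun s => \prod_(a <- r) F a s).
Proof.
move=> h; elim: r => [|a r IH].
  rewrite (_ : (fun s => _) = (fun=> 1)); first exact: ccontinuous_cst.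
  by apply/funext => s; rewrite big_nil.
rewrite (_ : (fun s => _) = (fun s => F a s * \prod_(b <- r) F b s)).
  exact: ccontinuousM.
by apply/funext => s; rewrite big_cons.
Qed.

Context {c : nat}.
Implicit Types A : R -> 'M[R[i]]_c.

Lemma ccontinuous_det J A : (forall j k, ccontinuous J (fun s => A s j k)) ->
  ccontinuous J (fun s => \det (A s)).
Proof.
move=> cA; apply: ccontinuous_sum => p; apply: ccontinuousM.
  exact: ccontinuous_cst.
exact: ccontinuous_prod.
Qed.

Lemma ccontinuous_lie J K A : (forall j k, ccontinuous J (fun s => A s j k)) ->
  forall j k, ccontinuous J (fun s => lie K (A s) j k).
Proof.
move=> cA j k.
rewrite (_ : (fun s => _) =
    (fun s => \sum_a K j a * A s a k + (-1) * \sum_a A s j a * K a k)).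
  apply: ccontinuousD; last apply: ccontinuousM; try exact: ccontinuous_cst;
  by apply: ccontinuous_sum => a; apply: ccontinuousM => //; exact: ccontinuous_cst.
by apply/funext => s; rewrite !mxE mulN1r.
Qed.

Lemma cderive_lie K A (t : R) (D : 'M[R[i]]_c) :
  (forall j k, cderive (fun s => A s j k) t (D j k)) ->
  forall j k, cderive (fun s => lie K (A s) j k) t (lie K D j k).
Proof.
move=> dA j k; rewrite !mxE.
rewrite (_ : (fun s => _) =
    (fun s => \sum_a K j a * A s a k - \sum_a A s j a * K a k)).
  apply: cderiveB; first by apply: cderive_sum => a; exact: cderiveZ.
  under eq_bigr do rewrite mulrC.
  rewrite (_ : (fun s => _) = (fun s => \sum_a K a k * A s j a)).
    by apply: cderive_sum => a; exact: cderiveZ.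
  by apply/funext => s; apply: eq_bigr => a _; rewrite mulrC.
by apply/funext => s; rewrite !mxE.
Qed.

End ComplexCurves.

Section Commutant.
Context {R : realType} {c l : nat} (P : 'I_l -> 'M[R[i]]_c).
Hypothesis hP : complete_projections P.

Definition in_commutant (K : 'M[R[i]]_c) := forall a, lie K (P a) = 0.

Lemma lie_comb K q : in_commutant K -> lie K (comb P q) = 0.
Proof.
by move=> hK; rewrite lie_sum big1 // => a _; rewrite lieZ hK scaler0.
Qed.

(** These compressions are the only elements of the commutant ever tested. *)
Lemma compression_in_commutant a Y : in_commutant (P a *m Y *m P a).
Proof.
move=> b; rewrite /lie -!mulmxA (mulmxA (P b)) !proj_mul //.
rewrite eq_sym; case: eqP => [->|_]; first by rewrite !scale1r subrr.
by rewrite !scale0r !mul0mx !mulmx0 subrr.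
Qed.

Lemma proj_in_commutant a : in_commutant (P a).
Proof.
by have := @compression_in_commutant a 1%:M; rewrite mulmx1 proj_mul // eqxx scale1r.
Qed.

Lemma proj_diag_ge0 a k : 0 <= P a k k.
Proof.
have := proj_mul hP a a; rewrite eqxx scale1r -{1}(proj_ctr hP) => <-.
by rewrite mxE sumr_ge0 // => j _; rewrite !mxE mulrC -normCK exprn_ge0.
Qed.

Lemma proj_diag_gt0 a : exists k, 0 < P a k k.
Proof.
have [k Pk] : exists k, P a k k != 0.
  apply: contrapT => /forallNP n; have := proj_tr_gt0 hP a.
  by rewrite /mxtrace big1 ?ltxx // => k _; apply/eqP/negP => /negP; exact: n.
by exists k; rewrite lt_def Pk proj_diag_ge0.
Qed.

(** Put B = P_a rho = rho P_a.  Commutation of rho with P_a E P_a, for E the matrix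
unit in position (y, k), reads P_xy B_kk = B_xy P_kk in entry (x, k); with
P_kk nonzero this makes B the multiple B_kk / P_kk of P_a. *)
Lemma bicommutant rho : (forall K, in_commutant K -> lie K rho = 0) ->
  forall a, exists z, P a *m rho = z *: P a.
Proof.
move=> h a; have [k /lt0r_neq0 Pk] := proj_diag_gt0 a.
have rP : P a *m rho = rho *m P a.
  by apply/eqP; rewrite -subr_eq0; apply/eqP/h/proj_in_commutant.
exists ((P a *m rho) k k / P a k k); apply/matrixP => x y.
have := h _ (@compression_in_commutant a (delta_mx y k)).
move=> /(congr1 (fun M : 'M[R[i]]_c => M x k)).
have delta (A B : 'M[R[i]]_c) : (A *m (delta_mx y k *m B)) x k = A x y * B k k.
  rewrite mulmxA mxE (bigD1 k) //= big1 ?addr0 => [|j jk].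
    rewrite mxE (bigD1 y) //= big1 ?addr0 => [|j jy].
      by rewrite mxE !eqxx mulr1.
    by rewrite mxE (negPf jy) mulr0.
  rewrite mxE big1 ?mul0r // => b _; rewrite mxE (negPf jk) andbF mulr0 //.
have -> : lie (P a *m delta_mx y k *m P a) rho =
    P a *m (delta_mx y k *m (P a *m rho)) - P a *m rho *m (delta_mx y k *m P a).
  by rewrite /lie [X in _ = _ - X *m _]rP !mulmxA.
rewrite [LHS]mxE [X in _ + X]mxE !delta [RHS]mxE => /eqP; rewrite subr_eq0 => /eqP e.
by rewrite [RHS]mxE mulrAC [X in X / _]mulrC e mulfK.
Qed.

(** The coefficients found by [bicommutant] are positive: evaluate the positive
form of rho on a column of the corresponding projection. *)
Lemma commutant_comm_density rho : density rho ->
  (forall K, in_commutant K -> lie K rho = 0) -> comm_density P rho.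
Proof.
move=> hrho /bicommutant h; have [herm pd tr1] := hrho.
have /choice[z zP] a : exists q : R, 0 < q /\ P a *m rho = q%:C *: P a.
  have [[z zE] [k Pk]] := (h a, proj_diag_gt0 a).
  have PP : P a *m P a = P a by rewrite proj_mul // eqxx scale1r.
  have z0 : 0 < z.
    have := pd (P a *m delta_mx k 0); rewrite ctrM (proj_ctr hP).
    rewrite -!mulmxA (mulmxA rho) (mulmxA (P a)) (mulmxA (P a) rho) zE -scalemxAl PP.
    have -> : (delta_mx k 0 : 'cV[R[i]]_c)^t* = delta_mx 0 k.
      by apply/matrixP => a' b; rewrite !mxE conjC_nat andbC.
    rewrite -scalemxAl -scalemxAr mxE -rowE -colE !mxE => pdz.
    have : 0 < z * P a k k.
      apply: pdz; apply: contraTneq Pk => /matrixP/(_ k 0).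
      by rewrite !mxE => ->; rewrite ltxx.
    by rewrite pmulr_lgt0.
  exists (complex.Re z); rewrite RRe_real ?gtr0_real // zE; split=> //.
  by rewrite -ltcR RRe_real ?gtr0_real.
apply/(comm_densityP hP).
have rhoE : rho = comb P z.
  have [_ _ _ s1] := hP.
  rewrite -[LHS]mul1mx -s1 mulmx_suml; apply: eq_bigr => a _.
  by have [_ ->] := zP a.
exists z => //; split=> [a|]; first by have [] := zP a.
by apply: complexI; rewrite -comb_tr // -rhoE tr1.
Qed.

End Commutant.

(** * Invariance of the commutative submanifold under the flow *)

Section FlowInvariance.
Context {R : realType} {V : finType} {c : nat} (G : wgraph R V).
Implicit Types (K : 'M[R[i]]_c) (g : R -> V -> 'M[R[i]]_c).

(** The real and imaginary parts of all entries of the [K, g t i], over all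
vertices i, form the finite family to which [gronwall_zero] applies.  The
equivalence covers both directions of time. *)
Lemma flow_lie_zero (J : set R) g K (a b : R) : qflow_solution G J g ->
  J a -> J b -> a <= b ->
  (forall i, lie K (g a i) = 0) <-> (forall i, lie K (g b i) = 0).
Proof.
move=> [Jint gQ gcont gder] Ja Jb ab.
have Jab : `[a, b]%classic `<=` J.
  by move=> t; rewrite /= in_itv /= => tab; exact: Jint Ja Jb _ tab.
have Jint' t : t \in `]a, b[ -> interior J t.
  move=> tab; have : nbhs t `]a, b[%classic by exact: open_nbhs_nbhs.
  by apply: filterS => s /=; move=> sab; apply: Jab; exact: subset_itv_oo_cc.
have gc i j k : ccontinuous `[a, b]%classic (fun s => g s i j k).
  have [h1 h2] := gcont i j k.
  by split; apply: continuous_subspaceW; eassumption.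
(* Compactness: one lower bound for all determinants on [a, b]. *)
have [delta d0 dP] : exists2 delta : R, 0 < delta & forall s i, s \in `[a, b] ->
    delta <= complex.Re (\det (g s i)).
  have /choice[m mP] i : exists m : R, 0 < m /\ forall s, s \in `[a, b] ->
      m <= complex.Re (\det (g s i)).
    have [cdet _] := ccontinuous_det (gc i).
    have [s sab smin] := EVT_min ab cdet.
    exists (complex.Re (\det (g s i))); split=> //.
    by apply: density_det_gt0; apply: gQ; exact: Jab.
  exists (\big[Order.min/1]_i m i).
    by apply: lt_bigmin => // i _; have [] := mP i.
  move=> s i sab; apply: (bigmin_inf i) => //.
  by have [_] := mP i; apply.
have [L L0 LP] := replicator_lie_bound (c := c) G d0.
pose part (b : bool) (z : R[i]) := if b then complex.Re z else complex.Im z.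
pose y (n : V * 'I_c * 'I_c * bool) s :=
  part n.2 (lie K (g s n.1.1.1) n.1.1.2 n.1.2).
pose dy (n : V * 'I_c * 'I_c * bool) s :=
  part n.2 (lie K (qreplicators (g s) (similarity G (g s)) n.1.1.1) n.1.1.2 n.1.2).
have y0 s : (forall i, lie K (g s i) = 0) <-> forall n, y n s = 0.
  split=> [h [[[i j] k] []]|h i]; try by rewrite /y /= h mxE.
  apply/matrixP => j k; apply/eqP; rewrite [X in _ == X]mxE eq_complex.
  have re0 := h (i, j, k, true); have im0 := h (i, j, k, false).
  by rewrite /y /= in re0 im0; rewrite re0 im0 eqxx.
rewrite !y0; apply: (@gronwall_zero _ _ y dy _ _ (L * (#|V| * (c * c))%:R *+ 2)) => //.
- by rewrite mulrn_wge0 // mulr_ge0.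
- move=> [[[i j] k] []]; by have [] := ccontinuous_lie K (gc i) j k.
- move=> t tab [[[i j] k] bb].
  have := cderive_lie K (fun j k => gder t (Jint' t tab) i j k) j k.
  by case: bb => -[].
- move=> t tab M yM [[[i j] k] bb].
  have tab' : t \in `[a, b] by exact: subset_itv_oo_cc.
  have entry i' j' k' : `|lie K (g t i') j' k'| <= (M *+ 2)%:C.
    by apply: normc_le; [exact: yM (i', j', k', true)|exact: yM (i', j', k', false)].
  have : `|lie K (qreplicators (g t) (similarity G (g t)) i) j k| <=
      (L * (#|V| * (c * c))%:R *+ 2 * M)%:C.
    apply: le_trans (entry_le_nrm _ _ _) _.
    have := LP (g t) K (gQ _ (Jab _ tab')) (fun i => dP t i tab') i.
    move=> /le_trans; apply.
    rewrite (_ : L * _ *+ 2 * M = L * ((#|V| * (c * c))%:R * (M *+ 2))); last by ring.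
    rewrite rmorphM ler_wpM2l ?ler0c //.
    apply: (@le_trans _ _ (\sum_(k' : V) \sum_(j' < c) \sum_(l' < c) (M *+ 2)%:C)).
      by do 3![apply: ler_sum => ? _]; exact: entry.
    rewrite !sumr_const !card_ord -!mulrnA mulr_natl mulnA mulnC.
    by rewrite !rmorphMn.
  by case: bb => h; rewrite /dy /=; [exact: Re_le_norm|exact: Im_le_norm].
Qed.

Lemma flow_preserved_comm_Q (l : nat) (P : 'I_l -> 'M[R[i]]_c) :
  complete_projections P -> flow_preserved G (comm_Q P).
Proof.
move=> hP J g t0 sol Jt0 g0 t Jt i; have [_ gQ _ _] := sol.
apply: (commutant_comm_density hP) => [|K hK]; first exact: gQ.
have K0 : forall i, lie K (g t0 i) = 0.
  by move=> k; have /(comm_densityP hP)[q _ ->] := g0 k; exact: lie_comb.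
have [tt|/ltW tt] := leP t0 t.
  by have [h _] := flow_lie_zero K sol Jt0 Jt tt; exact: h K0 i.
by have [_ h] := flow_lie_zero K sol Jt Jt0 tt; exact: h K0 i.
Qed.

End FlowInvariance.

(** * Tangent vectors and the classical flow *)

Section BlockDiagonal.
Context {R : realType} {V : finType} {c : nat}.
Implicit Types A B : V -> 'M[R[i]]_c.

(** The blocks have equal sizes, so the casts that conform them to the index type
of their row are trivial. *)
Lemma block_diagE B :
  block_diag B = \mxblock_(a < #|V|, b < #|V|) (if a == b then B (enum_val a) else 0).
Proof. by apply: eq_mxblock => a b; rewrite conform_mx_id. Qed.

Lemma block_diag_mul A B :
  block_diag A *m block_diag B = block_diag (fun i => A i *m B i).
Proof.
rewrite [block_diag B]block_diagE [LHS]mul_mxdiag_mxblock block_diagE.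
apply: eq_mxblock => a b.
by case: (a == b); rewrite // mulmx0.
Qed.

Lemma block_diag_ctr A : (block_diag A)^t* = block_diag (fun i => (A i)^t*).
Proof.
rewrite /block_diag tr_mxdiag.
have E B : \mxdiag_(a < #|V|) B (enum_val a) = block_diag B by [].
rewrite (E (fun i => (A i)^T)) (E (fun i => (A i)^t*)) !block_diagE.
apply/matrixP => a b; rewrite !mxE.
by case: (_ == _); rewrite !mxE ?rmorph0.
Qed.

Lemma block_diag_ext A B : (forall i, A i = B i) -> block_diag A = block_diag B.
Proof. by move=> h; apply: eq_mxdiag => a; rewrite h. Qed.

End BlockDiagonal.

Section Tangent.
Context {R : realType} {V : finType} {c : nat}.
Implicit Types (f h : R -> R[i]) (mu X : V -> 'M[R[i]]_c).

Lemma cderive_conj f t d : cderive f t d ->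
  cderive (fun s => Num.conj (f s)) t (Num.conj d).
Proof.
move=> [f1 f2]; split.
  by rewrite (_ : (fun s => _) = (fun s => complex.Re (f s)));
    [case: d f1 f2|apply/funext => s; case: (f s)].
rewrite (_ : (fun s => _) = (fun s => - complex.Im (f s))).
  by have := is_deriveN f2; case: d f1 f2.
by apply/funext => s; case: (f s).
Qed.

(** Linear identities that hold along a curve pass to its velocity through this
uniqueness. *)
Lemma cderive_near_unique f h (t : R) d d' : cderive f t d -> cderive h t d' ->
  (\near t, f t = h t) -> d = d'.
Proof.
move=> [f1 f2] [h1 h2] fh; apply/eqP; rewrite eq_complex; apply/andP; split; apply/eqP.
  have : \near t, complex.Re (f t) = complex.Re (h t) by apply: filterS fh => s ->.
  by move=> /near_eq_is_derive/(_ f1) [_ <-]; case: h1.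
have : \near t, complex.Im (f t) = complex.Im (h t) by apply: filterS fh => s ->.
by move=> /near_eq_is_derive/(_ f2) [_ <-]; case: h2.
Qed.

Lemma tangent_density mu (M : set (V -> 'M[R[i]]_c)) :
  M `<=` Qmanifold -> tangent M mu `<=` tangent_Q mu.
Proof.
move=> MQ X [g [e [e0 g0 gM gX]]] i.
have dg j k : cderive (fun s => g s i j k) 0 (X i j k) := gX i j k.
have near_dens : \forall s \near (0 : R), density (g s i).
  apply: filterS (pseudometric_normed_Zmodule.nbhs0_lt e0) => s se.
  by have [gs _] := gM s se; exact: MQ gs i.
split.
  apply/HermE/matrixP => j k; rewrite !mxE.
  apply: cderive_near_unique (cderive_conj (dg k j)) (dg j k) _.
  by apply: filterS near_dens => s [/HermE gE _ _]; rewrite -{2}gE !mxE.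
apply: cderive_near_unique (cderive_sum _ (fun j => dg j j)) (cderive_cst 1 0) _.
by apply: filterS near_dens => s [_ _ <-].
Qed.

Context {l : nat} (P : 'I_l -> 'M[R[i]]_c) (hP : complete_projections P).

Lemma comb_line_cderive (q x : 'I_l -> R) (t : R) j k :
  cderive (fun s => comb P (fun a => q a + s * x a) j k) t (comb P x j k).
Proof.
rewrite /comb summxE (_ : (fun s => _) =
    (fun s => \sum_a P a j k * (q a + s * x a)%:C)); last first.
  by apply/funext => s; rewrite summxE; apply: eq_bigr => a _; rewrite mxE mulrC.
apply: cderive_sum => a; rewrite mxE mulrC; apply: cderiveZ; split => /=.
  have d1 : is_derive t 1 (fun s : R => x a * s) (x a).
    by apply: (@is_derive_eq _ _ _ (x a \*: (@id R))); rewrite /GRing.scale /= mulr1.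
  have := is_deriveD (is_derive_cst (q a) t 1) d1; rewrite add0r.
  by under eq_fun do rewrite mulrC.
exact: is_derive_cst.
Qed.

(** The line q + t x keeps the trace, and stays positive for t below the smallest
of the numbers q_a / (1 + |x_a|); the 1 avoids a division by zero. *)
Lemma tangent_comb (q x : V -> 'I_l -> R) :
  (forall i a, 0 < q i a) -> (forall i, \sum_a q i a * prank P a = 1) ->
  (forall i, \sum_a x i a * prank P a = 0) ->
  tangent (comm_Q P) (fun i => comb P (q i)) (fun i => comb P (x i)).
Proof.
move=> q0 q1 x0.
exists (fun t i => comb P (fun a => q i a + t * x i a)).
exists (\big[Order.min/1]_(n : V * 'I_l) (q n.1 n.2 / (1 + `|x n.1 n.2|))).
have pos n : 0 < 1 + `|x n.1 n.2| by rewrite ltr_wpDr.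
split.
- by apply: lt_bigmin => // n _; rewrite divr_gt0.
- apply/funext => i; congr comb; apply/funext => a.
  by rewrite mul0r addr0.
- move=> t te; split; last first.
    by exists (fun i => comb P (x i)) => i j k; exact: comb_line_cderive.
  move=> i; apply/(comm_densityP hP); exists (fun a => q i a + t * x i a) => //.
  split=> [a|].
    have : `|t| < q i a / (1 + `|x i a|).
      by apply: lt_le_trans te _; exact: (bigmin_le _ (i, a)).
    rewrite ltr_pdivlMr ?(pos (i, a)) // => h.
    rewrite -ltrBlDl sub0r ltrNl; apply: le_lt_trans h.
    by rewrite (le_trans (ler_norm _)) // normrN normrM ler_wpM2l // lerDr.
  under eq_bigr do rewrite mulrDl -mulrA.
  by rewrite big_split /= -mulr_sumr x0 mulr0 addr0.
- by move=> i j k; exact: comb_line_cderive.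
Qed.

Context (G : wgraph R V).

Lemma comm_Q_coords mu : comm_Q P mu -> exists q : V -> 'I_l -> R,
  [/\ forall i a, 0 < q i a, forall i, \sum_a q i a * prank P a = 1 &
      mu = fun i => comb P (q i)].
Proof.
move=> h; have /choice[q qP] i : exists q : 'I_l -> R,
    [/\ forall a, 0 < q a, \sum_a q a * prank P a = 1 & mu i = comb P q].
  by have /(comm_densityP hP)[q [? ?] ?] := h i; exists q.
by exists q; split; last apply/funext; move=> i; have [] := qP i.
Qed.

Lemma similarity_comb (q : V -> 'I_l -> R) i :
  similarity G (fun i => comb P (q i)) i =
  comb P (fun a => \sum_(k in nbhood (edge G) i) weight G i k * q k a).
Proof.
rewrite /similarity /comb; under eq_bigr do rewrite scaler_sumr.
rewrite exchange_big; apply: eq_bigr => a _ /=.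
rewrite rmorph_sum scaler_suml; apply: eq_bigr => k _.
by rewrite scalerA rmorphM.
Qed.

Lemma replicator_tangent mu : comm_Q P mu ->
  tangent (comm_Q P) mu (qreplicators mu (similarity G mu)).
Proof.
move=> /comm_Q_coords[q [q0 q1 ->]].
pose y i a := \sum_(k in nbhood (edge G) i) weight G i k * q k a.
rewrite (_ : qreplicators _ _ = fun i => comb P (fun a =>
    q i a * y i a - (\sum_b q i b * y i b * prank P b) * q i a)).
  apply: tangent_comb => // i.
  under eq_bigr do rewrite mulrBl -[X in _ - X]mulrA.
  by rewrite sumrB -mulr_sumr q1 mulr1 subrr.
by apply/funext => i; rewrite /qreplicators similarity_comb qreplicator_comb.
Qed.

End Tangent.

Section Classical.
Context {R : realType} {V : finType} {c : nat} (G : wgraph R V).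
Context (u : 'I_c -> 'cV[R[i]]_c) (hu : orthonormal_basis u).
Local Notation U := (basis_mx u).

Lemma comb_rank1 (x : 'cV[R]_c) :
  comb (rank1_projections u) (fun a => x a 0) = U *m Diag x *m U^t*.
Proof.
rewrite /comb (basis_mx_diag u (fun a => (x a 0)%:C)); congr (_ *m diag_mx _ *m _).
by apply/rowP => a; rewrite !mxE.
Qed.

Lemma rank1_prank a : prank (rank1_projections u) a = 1.
Proof. by rewrite /prank rank1_tr. Qed.

Lemma unitary_Diag_inj (x y : 'cV[R]_c) :
  U *m Diag x *m U^t* = U *m Diag y *m U^t* -> x = y.
Proof.
have UU := basis_mx_ctr_mul hu.
move=> /(congr1 (fun M => U^t* *m M *m U)).
rewrite !mulmxA UU !mul1mx -!mulmxA UU !mulmx1 => /matrixP e.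
apply/colP => a; apply: complexI; have := e a a.
by rewrite !mxE eqxx !mulr1n.
Qed.

Lemma qreplicators_classical (S : V -> 'cV[R]_c) mu : Wmanifold S ->
  (forall i, mu i = U *m Diag (S i) *m U^t*) -> forall i,
  qreplicators mu (similarity G mu) i =
  U *m Diag (replicators S (csimilarity G S) i) *m U^t*.
Proof.
move=> WS muE i.
have -> : mu = fun i => comb (rank1_projections u) (fun a => S i a 0).
  by apply/funext => k; rewrite comb_rank1.
rewrite /qreplicators similarity_comb qreplicator_comb; last 2 first.
- exact: rank1_complete.
- by have [] := WS i.
rewrite -comb_rank1; congr comb; apply/funext => a.
rewrite /replicators /replicator_mx mulmxBl mul_diag_mx !mxE.
have yE b : csimilarity G S i b 0 =
    \sum_(k in nbhood (edge G) i) weight G i k * S k b 0.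
  by rewrite summxE; apply: eq_bigr => k _; rewrite mxE.
rewrite yE mulr_suml; congr (_ - _); apply: eq_bigr => b _.
by rewrite rank1_prank mulr1 !mxE big_ord1 !mxE yE; ring.
Qed.

End Classical.

Theorem proposition4p21 (R : realType) (V : finType) (G : wgraph R V)
    (c l : nat) (P : 'I_l -> 'M[R[i]]_c)
    (hl : (l <= c)%N) (hP : complete_projections P) :
  [/\ (forall mu : V -> 'M[R[i]]_c, comm_Q P mu ->
         [/\ Qmanifold mu,
             tangent (comm_Q P) mu (qreplicators mu (similarity G mu))
           & tangent (comm_Q P) mu `<=` tangent_Q mu]),
      (forall u : 'I_c -> 'cV[R[i]]_c, orthonormal_basis u ->
       forall mu : V -> 'M[R[i]]_c, comm_Q (rank1_projections u) mu ->
       let U := basis_mx u in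
       let Uc := block_diag (fun _ : V => U) in
       (exists! S : V -> 'cV[R]_c,
          Wmanifold S /\ forall i, mu i = U *m Diag (S i) *m U^t*) /\
       (forall S : V -> 'cV[R]_c, Wmanifold S ->
          (forall i, mu i = U *m Diag (S i) *m U^t*) ->
          block_diag (qreplicators mu (similarity G mu)) =
            Uc *m block_diag (fun i => Diag (replicators S (csimilarity G S) i))
               *m Uc^t* /\
          forall i, qreplicators mu (similarity G mu) i =
            U *m Diag (replicators S (csimilarity G S) i) *m U^t*))
    & flow_preserved G (comm_Q P)].
Proof.
split.
- move=> mu hmu; have MQ : comm_Q P `<=` @Qmanifold R V c.
    by move=> nu hnu i; apply: comm_density_density hP _ (hnu i).
  split; [exact: MQ|exact: replicator_tangent|exact: tangent_density].
- move=> u hu mu hmu U Uc; have UU := basis_mx_ctr_mul hu.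
  split.
    have hQ := rank1_complete hu.
    have [q [q0 q1 muE]] := comm_Q_coords hQ hmu.
    have qE i : comb (rank1_projections u) (q i) = U *m Diag (\col_a q i a) *m U^t*.
      by rewrite -comb_rank1; congr comb; apply/funext => a; rewrite mxE.
    exists (fun i => \col_a q i a); split=> [|S' [_ S'E]].
      split=> i; last by rewrite muE qE.
      split=> [a|]; first by rewrite mxE.
      rewrite -[RHS](q1 i); apply: eq_bigr => a _.
      by rewrite rank1_prank // mulr1 mxE.
    apply/funext => i; apply: (unitary_Diag_inj hu).
    by rewrite -S'E muE qE.
  move=> S WS muE; have RE := qreplicators_classical G hu WS muE.
  split=> //; rewrite block_diag_ctr !block_diag_mul.
  exact: block_diag_ext.
- exact: flow_preserved_comm_Q.
Qed.
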